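(* (Generalized Daleckiĭ–Kreĭn formula.) Let $r,k,n,m\ge 1$ be integers, let $\Omega\subseteq\mathbb{C}$ be open, and let $A(x)$ be an $n\times n$ complex matrix depending on $x=(x_1,\dots,x_r)\in\mathbb{R}^r$. Assume that $A$ is $k$ times differentiable at $\bar{x}$, that $A(x)\in M_n(\Omega,m)$ for all $x$ in some neighborhood of $\bar{x}$, and that $f$ is $(k+1)m-1$ times continuously differentiable on $\Omega$. Assume further that $A(\bar{x})$ is Hermitian, and let $Q$ be unitary with $Q^*A(\bar{x})Q=\mathrm{diag}(\lambda_1,\dots,\lambda_n)$. For a multi-index $\alpha$ put $U^{(\alpha)}=Q^*\big(\partial^\alpha A(x)|_{x=\bar{x}}\big)Q$. Then for every multi-index $\alpha$ with $|\alpha|=k$ and all $i,j\in\{1,\dots,n\}$, $$\big(Q^*(\partial^\alpha f(A(x))|_{x=\bar{x}})Q\big)_{i,j}=\sum_{\ell=1}^{|\alpha|}\ \sum_{t\in T_\alpha^\ell}\ \sum_{k_1=1}^n\cdots\sum_{k_{\ell-1}=1}^n U^{(t_1)}_{i,k_1}U^{(t_2)}_{k_1,k_2}\cdots U^{(t_\ell)}_{k_{\ell-1},j}\, f[\lambda_i,\lambda_{k_1},\dots,\lambda_{k_{\ell-1}},\lambda_j],$$ where for $\ell=1$ the summand is $U^{(t_1)}_{i,j}f[\lambda_i,\lambda_j]$ (no inner sums), and members $t=(t_1,\dots,t_\ell)$ of the multi-set $T_\alpha^\ell$ are counted with multiplicity.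
   Context: For an open set $\Omega\subseteq\mathbb{C}$, $M_n(\Omega,m)$ denotes the set of $n\times n$ complex matrices whose spectrum is contained in $\Omega$ and whose largest Jordan block has size at most $m$. For a scalar function $f:\Omega\to\mathbb{C}$ (differentiability on $\Omega$ is with respect to the complex variable), $f(A)$ denotes the matrix function in the standard sense, defined through the Jordan canonical form (equivalently Hermite interpolation) of $A$. $f[\mu_0,\dots,\mu_\ell]$ denotes the divided difference of $f$ at the points $\mu_0,\dots,\mu_\ell$ (with the usual confluent definition, using derivatives of $f$, when points coincide). For a multi-index $\alpha$ with $|\alpha|\ge 1$, the multi-set $S_\alpha^k$ of partitions of $\alpha$ into $k$ nonzero multi-indices (each partition being itself a multi-set, i.e. order does not matter) is defined recursively: $S_\alpha^0=\emptyset$; $S_\alpha^1$ has the single member $\{\alpha\}$; $S_\alpha^k=\emptyset$ for $k>|\alpha|$; and for $1<k\le|\alpha|$, write $\alpha=\beta+\gamma$ with $|\gamma|=1$, and let $S_\alpha^k$ consist of (i) one member $\{u_1,\dots,u_{k-1},\gamma\}$ for each $u=\{u_1,\dots,u_{k-1}\}\in S_\beta^{k-1}$, and (ii) the $k$ members $\{u_1,\dots,u_l+\gamma,\dots,u_k\}$, $l=1,\dots,k$, for each $u=\{u_1,\dots,u_k\}\in S_\beta^k$. Duplicates are kept. $T_\alpha^k$ is the multi-set of $k$-tuples (ordered) obtained by taking, for each member $\{s_1,\dots,s_k\}$ of $S_\alpha^k$, all $k!$ permutations $(s_{\pi(1)},\dots,s_{\pi(k)})$ (duplicates kept), so $|T_\alpha^k|=k!\,|S_\alpha^k|$.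 Example: $T_{(2,1)}^2$ consists of $((2,0),(0,1))$ and $((0,1),(2,0))$ once each, and $((1,1),(1,0))$ and $((1,0),(1,1))$ twice each. *)

(* Defs.v *)
From HB Require Import structures.
From mathcomp Require Import all_boot all_order all_algebra.
From mathcomp Require Import all_fingroup.
From mathcomp Require Import complex.
From mathcomp Require Import all_classical all_reals.
From mathcomp Require Import topology normedtype derive.

Set Implicit Arguments.
Unset Strict Implicit.
Unset Printing Implicit Defensive.

Import Order.TTheory GRing.Theory Num.Theory.
Import numFieldNormedType.Exports.

Local Open Scope classical_set_scope.
Local Open Scope ring_scope.

(** Multi-indices *)

Notation mindex r := {ffun 'I_r -> nat}.

Section MultiIndex.
Variable r : nat.
Implicit Types (a : mindex r) (i : 'I_r).

Definition mi_size a : nat := (\sum_i a i)%N.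

Definition mi_unit i : mindex r := [ffun j => nat_of_bool (j == i)].

(* 0 repeated a_0 times, then 1 repeated a_1 times, and so on: a fixed way of
   writing a as a sum of unit multi-indices. *)
Definition mi_dirs a : seq 'I_r :=
  flatten [seq nseq (a i) i | i <- enum 'I_r].

Lemma mi_dirsK a : \sum_(i <- mi_dirs a) mi_unit i = a.
Proof.
apply/ffunP => j; rewrite sum_ffunE /mi_dirs big_flatten big_map big_enum /=.
rewrite (eq_bigr (fun i => (if i == j then a i else 0)%N)) => [|i _].
  by rewrite -big_mkcond big_pred1_eq.
rewrite big_nseq ffunE eq_sym; elim: (a i) => [|p IHp]; first by case: eqP.
by rewrite iterS IHp; case: (i == j).
Qed.

Lemma size_mi_dirs a : size (mi_dirs a) = mi_size a.
Proof.
rewrite /mi_dirs size_flatten /shape -map_comp sumnE big_map big_enum /=.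
by apply: eq_bigr => i _; rewrite size_nseq.
Qed.

(* Multi-sets are represented by lists enumerating them with multiplicity.
   Here s lists the directions of a, that is a = \sum_(i <- s) mi_unit i; the
   head of s gives the gamma in the decomposition a = beta + gamma, and its
   tail gives beta.  The choice of gamma does not affect the multi-set. *)
Fixpoint mi_partitions_rec (s : seq 'I_r) (k : nat) : seq (seq (mindex r)) :=
  if s isn't i :: s' then [::] else
  if k == 0%N then [::] else
  if k == 1%N then [:: [:: \sum_(j <- s) mi_unit j]] else
  if (size s < k)%N then [::] else
    [seq rcons u (mi_unit i) | u <- mi_partitions_rec s' k.-1] ++
    [seq set_nth 0 u l (u`_l + mi_unit i)
       | u <- mi_partitions_rec s' k, l <- iota 0 k].

(* The multi-set S_a^k *)
Definition mi_partitions a k := mi_partitions_rec (mi_dirs a) k.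

(* The multi-set T_a^k.  All k! permutations are listed, even when they yield
   equal tuples (unlike seq.permutations, which removes duplicates). *)
Definition mi_ordered_partitions a k : seq (k.-tuple (mindex r)) :=
  [seq [tuple s`_(p l) | l < k]
     | s : seq (mindex r) <- mi_partitions a k, p : 'S_k <- enum 'S_k].

End MultiIndex.

(** Complex-matrix-valued functions of a real vector.  C^(n x n) is treated as
    a real normed space through the pair (real part, imaginary part). *)

Section RealDerivatives.
Variables (R : realType) (r n : nat).
Implicit Types (F : 'rV[R]_r -> 'M[R[i]]_n) (x : 'rV[R]_r) (j : 'I_r).

Definition Re_mx F x : 'M[R]_n := map_mx (@complex.Re R) (F x).
Definition Im_mx F x : 'M[R]_n := map_mx (@complex.Im R) (F x).

(* Frechet differentiability *)
Definition mx_differentiable F x :=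
  differentiable (Re_mx F) x /\ differentiable (Im_mx F) x.

Definition mx_derivable F x (v : 'rV[R]_r) :=
  derivable (Re_mx F) x v /\ derivable (Im_mx F) x v.

Definition partial j F x : 'M[R[i]]_n :=
  map2_mx (@Complex R) (derive (Re_mx F) x (delta_mx 0 j))
                       (derive (Im_mx F) x (delta_mx 0 j)).

(* k times Frechet differentiable at x: for k > 1, the differential of F is
   defined near x and is k - 1 times differentiable at x; the differential is
   identified with its components, the partial derivatives. *)
Fixpoint times_differentiable k F x : Prop :=
  match k with
  | 0 => True
  | 1 => mx_differentiable F x
  | k'.+1 => (\forall y \near x, mx_differentiable F y) /\
             forall j, times_differentiable k' (partial j F) x
  end.

Fixpoint iter_partial (s : seq 'I_r) F : 'rV[R]_r -> 'M[R[i]]_n :=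
  if s is j :: s' then partial j (iter_partial s' F) else F.

Fixpoint has_iter_partial (s : seq 'I_r) F x : Prop :=
  if s is j :: s' then
    (\forall y \near x, has_iter_partial s' F y) /\
    mx_derivable (iter_partial s' F) x (delta_mx 0 j)
  else True.

(* d^a = d_0^(a_0) d_1^(a_1) ..., the last variables being differentiated
   first *)
Definition mi_partial (a : mindex r) F x := iter_partial (mi_dirs a) F x.
Definition has_mi_partial (a : mindex r) F x := has_iter_partial (mi_dirs a) F x.

End RealDerivatives.

(** Scalar functions of a complex variable.  R[i]^o is R[i] with its topology
    and its structure of normed space over itself, so that derivatives are
    complex derivatives. *)

Section ComplexFunctions.
Variable R : realType.
Implicit Types (f : R[i]^o -> R[i]^o) (Omega : set R[i]^o).

Definition times_cont_differentiable_on N f Omega :=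
  (forall l z, (l < N)%N -> Omega z -> derivable (derive1n l f) z 1) /\
  (forall z, Omega z -> {for z, continuous (derive1n N f)}).

(* The points of s rearranged so that equal points are contiguous *)
Definition group_points (s : seq R[i]) : seq R[i] :=
  flatten [seq nseq (count_mem z s) z | z <- undup s].

(* Expects s of size l.+1 with equal points contiguous; then its first and last
   points are equal only if all its points are. *)
Fixpoint divdiff_rec f (l : nat) (s : seq R[i]) : R[i] :=
  let a := head 0 s in let b := last 0 s in
  if l is l'.+1 then
    if a == b then derive1n l f a / (l`!)%:R
    else (divdiff_rec f l' (behead s) - divdiff_rec f l' (take l s)) / (b - a)
  else f a.

Definition divdiff f (s : seq R[i]) : R[i] :=
  divdiff_rec f (size s).-1 (group_points s).

End ComplexFunctions.

(** Jordan canonical form and matrix functions *)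

Section MatrixFunctions.
Variable R : realType.
Implicit Types (f : R[i]^o -> R[i]^o) (Omega : set R[i]^o).

Definition jordan_block p (z : R[i]) : 'M[R[i]]_p :=
  \matrix_(a, b) (if a == b then z else if b == a.+1 :> nat then 1 else 0).

Definition fun_jordan_block f p (z : R[i]) : 'M[R[i]]_p :=
  \matrix_(a, b) (if (a <= b)%N then derive1n (b - a) f z / ((b - a)`!)%:R
                   else 0).

(* The change of basis is a pair of mutually inverse matrices, of a priori
   different format n x (sum of the block sizes); they force equality. *)
Record jordan_form n (A : 'M[R[i]]_n) := JordanForm {
  jf_num : nat;
  jf_size : 'I_jf_num -> nat;
  jf_eig : 'I_jf_num -> R[i];
  jf_base : 'M[R[i]]_(n, \sum_b jf_size b);
  jf_inv : 'M[R[i]]_(\sum_b jf_size b, n);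
  jf_size_gt0 : forall b, (0 < jf_size b)%N;
  jf_baseV : jf_base *m jf_inv = 1%:M;
  jf_invV : jf_inv *m jf_base = 1%:M;
  jf_eq : A = jf_base *m (\mxdiag_b jordan_block (jf_size b) (jf_eig b))
                *m jf_inv }.

Arguments jf_size {n A} _ _.
Arguments jf_eig {n A} _ _.

Definition fun_jordan f n (A : 'M[R[i]]_n) (J : jordan_form A) : 'M[R[i]]_n :=
  jf_base J *m (\mxdiag_b fun_jordan_block f (jf_size J b) (jf_eig J b))
    *m jf_inv J.

(* f(A), computed from any Jordan form of A: the value does not depend on the
   form. *)
Definition matrix_fun f n (A : 'M[R[i]]_n) : 'M[R[i]]_n :=
  xget 0 [set B | exists J : jordan_form A, B = fun_jordan f J].

(* The set M_n(Omega, m) *)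
Definition spectral_class Omega m n : set 'M[R[i]]_n :=
  [set A | (forall z, eigenvalue A z -> Omega z) /\
           exists J : jordan_form A, forall b, (jf_size J b <= m)%N].

End MatrixFunctions.

(* Main.v *)
Require Import Defs.
From HB Require Import structures.
From mathcomp Require Import all_boot all_order all_algebra.
From mathcomp Require Import all_fingroup.
From mathcomp Require Import complex.
From mathcomp Require Import all_classical all_reals.
From mathcomp Require Import topology normedtype derive.
From mathcomp Require Import sequences trigo.
From mathcomp Require Import ring lra zify.

Set Implicit Arguments.
Unset Strict Implicit.
Unset Printing Implicit Defensive.

Import Order.TTheory GRing.Theory Num.Theory.
Import numFieldNormedType.Exports.

Local Open Scope classical_set_scope.
Local Open Scope sesquilinear_scope.
Local Open Scope ring_scope.

(** The idea is a holomorphic functional calculus in which contour integrals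
are replaced by ultralimits of averages over equally spaced nodes.

A complex C^1 function f satisfies a discrete Cauchy formula on small circles
around the eigenvalues of A(x0): contracting the circle to a point changes the
average of f against the Cauchy kernel by telescoping sums only.  This yields
a bounded linear functional L, playing the role of
phi |-> (2 i pi)^-1 \oint f phi, with L ((z - mu)^-(p+1)) = f^(p)(mu) / p!
for mu inside the circles.  Computing resolvents from Jordan forms gives
f(A(x)) = L ((z - A(x))^-1) for x near x0, whatever the Jordan form.

Differentiating the resolvent (z - A)^-1 repeatedly produces words
(z - A)^-1 A_(w_1) (z - A)^-1 ... A_(w_l) (z - A)^-1, where each new derivative
either splits a resolvent or falls on one of the A_(w_i); difference quotients
converge uniformly on the circles, so L commutes with the derivatives.  The
words of length l produced by alpha are the ordered partitions T_alpha^l.  At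
x0, in the eigenbasis, the entries of a word are sums over paths of products of
entries of the U's and of poles 1 / (z - lambda_q), and L maps such a product
of poles to the divided difference of f. *)

(** The Jordan structure of A(x) may jump at x0, so f(A(x)) cannot be differentiated through its
    Jordan forms. One functional L, fixed for all x near x0, leaves the resolvent as the only part
    that depends on x. Besides its values on poles, L is only used through linearity on functions
    bounded on the circles and continuity for uniform convergence there; averages over finitely many
    nodes keep both properties in the limit.

    The regularity of f enters through strict differentiability at each point of the discs. Being
    stable under products and under passage to nearby points, it becomes uniform on closed discs by
    compactness, and this compactness is again obtained from ultralimits. The discs have to be small
    enough to lie in Omega and to be far apart from each other. Eigenvalues of A(x) are then kept
    inside them by an elementary perturbation estimate in the eigenbasis of A(x0). *)

Local Notation nc := Normc.normc.
Local Notation "x %:C" := (real_complex _ x) : ring_scope.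

(** * The modulus of a complex number as a real number *)

Section ComplexModulus.
Variable R : realType.
Implicit Types z w : R[i].

Lemma normrc z : `|z| = (nc z)%:C.
Proof. by case: z => a b; rewrite normc_def. Qed.

Lemma nc_ge0 z : 0 <= nc z.
Proof. by case: z => a b; rewrite sqrtr_ge0. Qed.

Lemma nc0 : nc (0 : R[i]) = 0.
Proof. by apply: complexI; rewrite -normrc normr0. Qed.

Lemma nc1 : nc (1 : R[i]) = 1.
Proof. by apply: complexI; rewrite -normrc normr1. Qed.

Lemma ncD z w : nc (z + w) <= nc z + nc w.
Proof. by rewrite -lecR rmorphD /= -!normrc ler_normD. Qed.

Lemma ncN z : nc (- z) = nc z.
Proof. by apply: complexI; rewrite -!normrc normrN. Qed.

Lemma ncC z w : nc (z - w) = nc (w - z).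
Proof. by rewrite -ncN opprB. Qed.

Lemma ncM z w : nc (z * w) = nc z * nc w.
Proof. by apply: complexI; rewrite rmorphM /= -!normrc normrM. Qed.

Lemma ncV z : nc z^-1 = (nc z)^-1.
Proof. by apply: complexI; rewrite fmorphV /= -!normrc normfV. Qed.

Lemma ncX z p : nc (z ^+ p) = nc z ^+ p.
Proof. by apply: complexI; rewrite rmorphXn /= -!normrc normrX. Qed.

Lemma nc_eq0 z : (nc z == 0) = (z == 0).
Proof. by rewrite -(inj_eq (@complexI R)) -normrc normr_eq0. Qed.

Lemma nc_gt0 z : (0 < nc z) = (z != 0).
Proof. by rewrite lt_neqAle nc_ge0 andbT eq_sym nc_eq0. Qed.

Lemma nc_real (a : R) : nc a%:C = `|a|.
Proof. by rewrite /= expr0n /= addr0 sqrtr_sqr. Qed.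

Lemma nc_nat p : nc (p%:R : R[i]) = p%:R.
Proof.
rewrite (_ : p%:R = (p%:R : R)%:C); last by rewrite rmorph_nat.
by rewrite nc_real ger0_norm.
Qed.

Lemma nc_sum I (s : seq I) (P : pred I) (F : I -> R[i]) :
  nc (\sum_(i <- s | P i) F i) <= \sum_(i <- s | P i) nc (F i).
Proof.
elim/big_ind2 : _ => [|x x' y y' hx hy|//]; first by rewrite nc0.
by apply: le_trans (ncD _ _) _; exact: lerD.
Qed.

Lemma nc_distD z w y : nc (w - y) <= nc (w - z) + nc (z - y).
Proof. by rewrite -[w - y](subrKA z) ncD. Qed.

Lemma normr_Re_le z : `|complex.Re z| <= nc z.
Proof. by rewrite -lecR -normrc normc_ge_Re. Qed.

Lemma normr_Im_le z : `|complex.Im z| <= nc z.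
Proof.
case: z => a b /=; rewrite -sqrtr_sqr ler_wsqrtr // lerDr sqr_ge0 //.
Qed.

Lemma nc_le_ReIm z : nc z <= `|complex.Re z| + `|complex.Im z|.
Proof.
case: z => a b /=; rewrite -[leRHS]ger0_norm ?addr_ge0 // -[leRHS]sqrtr_sqr.
rewrite ler_wsqrtr // sqrrD !real_normK ?num_real // lerD2r lerDl.
by rewrite mulrn_wge0 // mulr_ge0.
Qed.

Lemma nc_le_eq0 z : (forall e : R, 0 < e -> nc z <= e) -> z = 0.
Proof.
move=> h; apply/eqP; rewrite -nc_eq0 eq_le nc_ge0 andbT.
by apply/ler_addgt0Pl => e e0; rewrite addr0; apply: h.
Qed.

End ComplexModulus.

Arguments Normc.normc : simpl never.

(* An ultrafilter gives every bounded sequence a limit, so that the averages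
   approximating contour integrals converge without any integrability. *)
Lemma ultra_nat_ex :
  exists U : set_system nat, UltraFilter U /\ \oo `<=` U.
Proof. exact: ultraFilterLemma. Qed.

Definition ultra_nat : set_system nat := projT1 (cid ultra_nat_ex).

#[global] Instance ultra_nat_ultra : UltraFilter ultra_nat.
Proof. by case: (projT2 (cid ultra_nat_ex)). Qed.

Lemma ultra_nat_oo : \oo `<=` ultra_nat.
Proof. by case: (projT2 (cid ultra_nat_ex)). Qed.

(** * Ultralimits of bounded complex sequences *)

Section Ultralimit.
Variable R : realType.

(** By compactness of [[-M, M]] the image of the ultrafilter clusters at some [l]. If the indices
    with [u i] close to [l] did not form a set of the ultrafilter, their complement would, against
    clustering. *)
Lemma ultralim_real_ex (u : nat -> R) M : (forall i, `|u i| <= M) ->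
  exists l, forall e, 0 < e -> ultra_nat [set i | `|u i - l| < e].
Proof.
move=> uM.
have uF : (u @ ultra_nat) `[-M, M]%classic.
  have : ultra_nat (u @^-1` `[-M, M]%classic).
    by apply: filterS filterT => i _ /=; rewrite in_itv /= -ler_norml.
  by [].
have [l [_ lcl]] := @segment_compact R (-M) M (u @ ultra_nat) _ uF.
exists l => e e0.
have [//|nU] := in_ultra_setVsetC [set i | `|u i - l| < e] ultra_nat_ultra.
pose B := [set y : R | ~ `|y - l| < e].
have nB : (u @ ultra_nat) B by [].
have nl : nbhs l (ball l e) by exact: nbhsx_ballx.
have [y [yB /=]] := lcl _ _ nB nl.
by rewrite /ball /= distrC.
Qed.

Definition cbounded T (G : set T) (u : T -> R[i]) :=
  exists M, forall i, G i -> nc (u i) <= M.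

Definition culim_spec (u : nat -> R[i]) l :=
  forall e, 0 < e -> ultra_nat [set i | nc (u i - l) <= e].

Definition culim (u : nat -> R[i]) : R[i] := xget 0 [set l | culim_spec u l].

Lemma culimP u : cbounded setT u -> culim_spec u (culim u).
Proof.
move=> [M uM].
have [a ha] := @ultralim_real_ex (fun i => complex.Re (u i)) M
  (fun i => le_trans (normr_Re_le (u i)) (uM i I)).
have [b hb] := @ultralim_real_ex (fun i => complex.Im (u i)) M
  (fun i => le_trans (normr_Im_le (u i)) (uM i I)).
suff : culim_spec u (Complex a b) by exact: xgetI.
move=> e e0; have e2 : 0 < e / 2 by rewrite divr_gt0.
apply: filterS2 (ha _ e2) (hb _ e2) => i /= hai hbi.
apply: le_trans (nc_le_ReIm _) _; rewrite [leRHS]splitr.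
by apply: lerD; case: (u i) hai hbi => x y /= /ltW ? /ltW ?.
Qed.

Lemma culim_unique u l : cbounded setT u -> culim_spec u l -> culim u = l.
Proof.
move=> /culimP h1 h2; apply/eqP; rewrite -subr_eq0; apply/eqP.
apply: nc_le_eq0 => e e0; have e2 : 0 < e / 2 by rewrite divr_gt0.
have [i [/= hi1 hi2]] := filter_ex (filterI (h1 _ e2) (h2 _ e2)).
apply: le_trans (nc_distD (u i) _ _) _; rewrite [leRHS]splitr.
by apply: lerD => //; rewrite ncC.
Qed.

Lemma culim_cvg u l : cbounded setT u ->
  (forall e, 0 < e -> exists N, forall i, (N <= i)%N -> nc (u i - l) <= e) ->
  culim u = l.
Proof.
move=> ub ul; apply: culim_unique => // e /ul [N hN].
by apply: ultra_nat_oo; exists N.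
Qed.

Lemma culimD u v : cbounded setT u -> cbounded setT v ->
  culim (fun i => u i + v i) = culim u + culim v.
Proof.
move=> ub vb; apply: culim_unique.
  case: ub vb => [M uM] [M' vM]; exists (M + M') => i _.
  by apply: le_trans (ncD _ _) _; rewrite lerD ?uM ?vM.
move=> e e0; have e2 : 0 < e / 2 by rewrite divr_gt0.
apply: filterS2 (culimP ub e2) (culimP vb e2) => i /= h1 h2.
rewrite opprD addrACA; apply: le_trans (ncD _ _) _; rewrite [leRHS]splitr.
exact: lerD.
Qed.

Lemma culimZ a u : cbounded setT u -> culim (fun i => a * u i) = a * culim u.
Proof.
move=> ub; apply: culim_unique.
  case: ub => [M uM]; exists (nc a * M) => i _.
  by rewrite ncM ler_wpM2l ?nc_ge0 ?uM.
move=> e e0; have a0 : 0 < nc a + 1 by rewrite ltr_wpDl ?nc_ge0.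
have e2 : 0 < e / (nc a + 1) by rewrite divr_gt0.
apply: filterS (culimP ub e2) => i /= h1.
rewrite -mulrBr ncM; apply: (@le_trans _ _ ((nc a + 1) * (e / (nc a + 1)))).
  by apply: ler_pM; rewrite ?nc_ge0 ?lerDl.
by rewrite mulrC divfK // gt_eqF.
Qed.

Lemma culim_le u M : (forall i, nc (u i) <= M) -> nc (culim u) <= M.
Proof.
move=> uM; apply/ler_addgt0Pl => e e0.
have ub : cbounded setT u by exists M.
have [i /= hi] := filter_ex (culimP ub e0).
rewrite -[culim u](subrK (u i)); apply: le_trans (ncD _ _) _.
by apply: lerD => //; rewrite ncC.
Qed.

End Ultralimit.

(** * The Cauchy formula for averages over roots of unity *)

Section RootsOfUnity.
Variable R : realType.

Definition cis (t : R) : R[i] := Complex (cos t) (sin t).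

Lemma cisD a b : cis (a + b) = cis a * cis b.
Proof. by apply/eqP; rewrite eq_complex /= cosD sinD addrC !eqxx /= [sin a * _ + _]addrC. Qed.

Lemma cis0 : cis 0 = 1.
Proof. by rewrite /cis cos0 sin0. Qed.

Lemma cis_pow t p : cis t ^+ p = cis (t *+ p).
Proof.
by elim: p => [|p IHp]; rewrite ?expr0 ?mulr0n ?cis0 // exprS mulrS cisD IHp.
Qed.

Lemma nc_cis t : nc (cis t) = 1.
Proof. by rewrite /cis /Normc.normc cos2sin2 subrK sqrtr1. Qed.

Lemma cis_neq1 t : 0 < t -> t < pi *+ 2 -> cis t != 1.
Proof.
move=> t0 t2; apply/negP => /eqP/(congr1 (@complex.Re R)) /= c1.
have : 0 < sin (t / 2).
  by apply: sin_gt0_pi; rewrite divr_gt0 //= ltr_pdivrMr // mulr_natr.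
have : cos t = 1 - sin (t / 2) ^+ 2 *+ 2.
  by rewrite [in LHS](splitr t) -mulr2n cos_mulr2n cos2sin2; ring.
by rewrite c1; nra.
Qed.

Lemma cis_cvg1 (e : R) : 0 < e ->
  exists2 d, 0 < d & forall t, 0 <= t -> t < d -> nc (cis t - 1) < e.
Proof.
move=> e0; have e2 : 0 < e / 2 by rewrite divr_gt0.
have /cvgrPdist_lt/(_ _ e2) := @continuous_cos R 0.
have /cvgrPdist_lt/(_ _ e2) := @continuous_sin R 0.
move=> [d1 /= d10 h1] [d2 /= d20 h2].
exists (Num.min d1 d2) => [|t t0]; rewrite ?lt_min ?d10 //= => /andP[t1 t2].
apply: le_lt_trans (nc_le_ReIm _) _; rewrite /= [ltRHS]splitr oppr0 addr0.
have := h1 t; rewrite sin0 /ball_ /= !sub0r !normrN => h1t.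
have := h2 t; rewrite cos0 /ball_ /= !sub0r !normrN distrC => h2t.
by apply: ltrD; rewrite ?h2t ?h1t // ger0_norm.
Qed.

(** With [N.+2] nodes the root differs from 1 for every [N], so that no lower bound on the number of
    nodes has to be carried along. *)
Definition unit_root N : R[i] := cis (pi *+ 2 / N.+2%:R).

Lemma nc_unit_root N : nc (unit_root N) = 1.
Proof. exact: nc_cis. Qed.

Lemma unit_root_pow N : unit_root N ^+ N.+2 = 1.
Proof.
rewrite cis_pow; have -> : pi *+ 2 / N.+2%:R *+ N.+2 = pi *+ 2 :> R.
  by rewrite -mulrnAl -[_ *+ N.+2]mulr_natr mulfK // pnatr_eq0.
by rewrite /cis cos2pi sin_mulr2n sinpi mulr0 mul0rn.
Qed.

Lemma unit_root_prim N p : (0 < p < N.+2)%N -> unit_root N ^+ p != 1.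
Proof.
case/andP=> p0 pN; have pi0 : 0 < pi *+ 2 :> R by rewrite mulrn_wgt0 // pi_gt0.
rewrite cis_pow -[_ *+ p]mulr_natr -mulrA; apply: cis_neq1.
  by rewrite mulr_gt0 // mulrC divr_gt0 // ltr0n.
by rewrite gtr_pMr // mulrC ltr_pdivrMr // mul1r ltr_nat.
Qed.

Lemma unit_root_cvg1 (e : R) : 0 < e ->
  exists N0, forall N, (N0 <= N)%N -> nc (unit_root N - 1) < e.
Proof.
move=> /cis_cvg1 [d d0 hd].
have pi0 : 0 <= pi *+ 2 :> R by rewrite mulrn_wge0 // pi_ge0.
have [N0 hN0] : exists N0 : nat, pi *+ 2 / d < N0%:R.
  by exists (Num.bound (pi *+ 2 / d)); apply: archi_boundP; rewrite divr_ge0 // ltW.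
exists N0 => N N0N; apply: hd; first by rewrite divr_ge0.
rewrite ltr_pdivrMr // mulrC -ltr_pdivrMr //; apply: lt_le_trans hN0 _.
by rewrite ler_nat; lia.
Qed.

End RootsOfUnity.

Section DiscreteCauchy.
Variable R : realType.
Implicit Types (h : R[i] -> R[i]) (a c mu : R[i]) (rho : R).

(** Both endpoints vary near [a]: the slope [d] then serves all base points close to [a], which is
    what the compactness argument of [strictly_diff_uniform] requires. *)
Definition strictly_diff h a := exists d, forall e : R, 0 < e ->
  exists2 dl : R, 0 < dl & forall u v, nc (u - a) < dl -> nc (v - a) < dl ->
    nc (h v - h u - d * (v - u)) <= e * nc (v - u).

(** If the radius [N.+1%:R^-1] fails at a point [a N] for every [N], the slope at the ultralimit of
    [a] also serves some [a i] close to it, a contradiction. *)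
Lemma strictly_diff_uniform h c rho :
  (forall a, nc (a - c) <= rho -> strictly_diff h a) ->
  forall e : R, 0 < e -> exists (dl : R) (d : R[i] -> R[i]), 0 < dl /\
  forall a, nc (a - c) <= rho ->
    forall u v, nc (u - a) < dl -> nc (v - a) < dl ->
    nc (h v - h u - d a * (v - u)) <= e * nc (v - u).
Proof.
move=> hsd e e0.
pose good dl a d := forall u v, nc (u - a) < dl -> nc (v - a) < dl ->
    nc (h v - h u - d * (v - u)) <= e * nc (v - u).
suff [dl dl0 hdl] : exists2 dl : R, 0 < dl & forall a, exists d,
    nc (a - c) <= rho -> good dl a d.
  by have [d hd] := choice hdl; exists dl, d; split.
apply: contrapT => hn.
have /choice [a ha] : forall N : nat, exists a, nc (a - c) <= rho /\
    forall d, ~ good (N.+1%:R^-1) a d.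
  move=> N; apply: contrapT => hN; apply: hn; exists N.+1%:R^-1 => [|a].
    by rewrite invr_gt0 ltr0n.
  apply: contrapT => hd; apply: hN; exists a; split => [|d gd].
    by apply: contrapT => hac; apply: hd; exists 0.
  by apply: hd; exists d.
have ab : cbounded setT a.
  exists (rho + nc c) => N _; rewrite -[a N](subrK c).
  by apply: le_trans (ncD _ _) _; rewrite lerD2r; case: (ha N).
have ac : nc (culim a - c) <= rho.
  apply/ler_addgt0Pr => e' e'0.
  have [i /= hi] := filter_ex (culimP ab e'0).
  apply: le_trans (nc_distD (a i) _ _) _.
  by rewrite addrC; apply: lerD; [case: (ha i) | rewrite ncC].
have [d /(_ e e0) [dl dl0 hd]] := hsd _ ac.
have dl2 : 0 < dl / 2 by rewrite divr_gt0.
have [N0 hN0] : exists N0 : nat, (dl / 2)^-1 < N0%:R.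
  by exists (Num.bound (dl / 2)^-1); apply: archi_boundP; rewrite invr_ge0 ltW.
have hU : ultra_nat [set i | (N0 <= i)%N] by apply: ultra_nat_oo; exists N0.
have [i [/= hi N0i]] := filter_ex (filterI (culimP ab dl2) hU).
have [_ /(_ d)] := ha i; apply => u v hu hv.
have hi1 : i.+1%:R^-1 <= dl / 2.
  rewrite -[leRHS]invrK lef_pV2 ?posrE ?invr_gt0 // ltW //.
  by apply: lt_le_trans hN0 _; rewrite ler_nat; lia.
apply: hd; apply: le_lt_trans (nc_distD (a i) _ _) _; rewrite [ltRHS]splitr;
  by apply: ltr_leD => //; apply: lt_le_trans hi1.
Qed.

Lemma root_sum (w : R[i]) N : w ^+ N = 1 -> w != 1 -> \sum_(s < N) w ^+ s = 0.
Proof.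
move=> wN w1; have := subrX1 w N; rewrite wN subrr => /esym/eqP.
by rewrite mulf_eq0 subr_eq0 (negbTE w1) => /eqP.
Qed.

(** Since [(p * w ^+ s) ^+ N = p ^+ N], each quotient is a geometric sum over the common denominator
    [p ^+ N - b ^+ N]. Summing over [s] kills all its terms but the one with [j = 0]. *)
Lemma cauchy_kernel_sum (w b p : R[i]) N :
  w ^+ N = 1 -> (forall q, (0 < q < N)%N -> w ^+ q != 1) -> (0 < N)%N ->
  p ^+ N != b ^+ N ->
  \sum_(s < N) (p * w ^+ s / (p * w ^+ s - b)) =
    N%:R * p ^+ N / (p ^+ N - b ^+ N).
Proof.
move=> wN wp N0 pb; have d0 : p ^+ N - b ^+ N != 0 by rewrite subr_eq0.
have key s : p * w ^+ s / (p * w ^+ s - b) =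
    (\sum_(j < N) (p ^+ (N - j) * b ^+ j) * (w ^+ (N - j)) ^+ s)
      / (p ^+ N - b ^+ N).
  set v := p * w ^+ s.
  have vN : v ^+ N = p ^+ N by rewrite exprMn exprAC wN expr1n mulr1.
  have vb : v - b != 0.
    by apply: contra pb; rewrite subr_eq0 => /eqP <-; rewrite vN.
  apply/eqP; rewrite eqr_div //; apply/eqP; rewrite -vN subrXX mulrCA [RHS]mulrC.
  congr (_ * _); rewrite mulr_sumr; apply: eq_bigr => j _.
  have -> : (N - j = (N.-1 - j).+1)%N by have := ltn_ord j; lia.
  by rewrite mulrA -exprS /v exprMn exprAC mulrAC.
under eq_bigr do rewrite key; rewrite -mulr_suml; congr (_ / _).
rewrite exchange_big /= (bigD1 (Ordinal N0)) //= [X in _ + X]big1 => [|j j0].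
  rewrite addr0 subn0 expr0 mulr1 -mulr_sumr wN mulrC; congr (_ * _).
  by under eq_bigr do rewrite expr1n; rewrite sumr_const card_ord.
rewrite -mulr_sumr root_sum ?mulr0 //; first by rewrite exprAC wN expr1n.
apply: wp; rewrite subn_gt0 ltn_ord /= ltn_subrL N0 andbT.
by rewrite lt0n; apply: contra j0 => /eqP j0; apply/eqP/val_inj.
Qed.

Definition node c rho N s : R[i] := c + rho%:C * unit_root R N ^+ s.

Lemma nc_node c rho N s : 0 <= rho -> nc (node c rho N s - c) = rho.
Proof.
move=> rho0; rewrite /node addrC addKr ncM ncX nc_unit_root expr1n mulr1.
by rewrite nc_real ger0_norm.
Qed.

(** Riemann sum of the integral of [phi] over the circle divided by [2 i pi]: there [dz / (2 i pi)]
    is [z - c] times the normalized angular measure, whence the weight [rho * w ^+ s]. *)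
Definition circle_mean c rho N (phi : R[i] -> R[i]) : R[i] :=
  N.+2%:R^-1 * \sum_(s < N.+2)
    (rho%:C * unit_root R N ^+ s * phi (node c rho N s)).

(* Discrete version of the homotopy t |-> mu + t (z - mu) contracting the
   circle to mu: along it the mean of h against the Cauchy kernel is almost
   constant, since its derivative is the mean of a telescoping sum. *)
Lemma circle_mean_contract h c rho mu : 0 < rho ->
  (forall a, nc (a - c) <= rho -> strictly_diff h a) ->
  nc (mu - c) < rho -> forall e, 0 < e ->
  exists N0, forall N, (N0 <= N)%N ->
    nc (circle_mean c rho N (fun z => h z / (z - mu)) -
        h mu * circle_mean c rho N (fun z => (z - mu)^-1)) <= e.
Proof.
move=> rho0 hsd hmu e e0.
set kap := rho - nc (mu - c).
have kap0 : 0 < kap by rewrite subr_gt0.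
(* [C] is chosen so that each of the [K.+1] steps of the contraction costs at most [e / K.+1]: its
   first term comes from the linearization errors weighted by [g], the second from the bound on
   [D]. *)
set C := 2 * rho * (rho / kap) + rho.
have C0 : 0 < C by rewrite ltr_wpDl // mulr_ge0 ?divr_ge0 ?mulr_ge0 // ltW.
have e10 : 0 < e / C by rewrite divr_gt0.
have [dl [d [dl0 hd]]] := strictly_diff_uniform hsd e10.
set e1 := e / C in e10 hd.
(* [N0] makes consecutive nodes closer than [dl]; [K] below makes each step of the contraction
   shorter than [dl]. *)
have [N0 hN0] := @unit_root_cvg1 R (dl / rho) (divr_gt0 dl0 rho0).
exists N0 => N /hN0 hw.
have [K hK] : exists K : nat, 2 * rho / dl < K.+1%:R.
  exists (Num.bound (2 * rho / dl)); apply: lt_trans (archi_boundP _) _.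
    by rewrite divr_ge0 ?mulr_ge0 ?ltW.
  by rewrite ltr_nat.
set w := unit_root R N; set z := node c rho N.
have w1 : w != 1 by apply: (@unit_root_prim _ N 1).
have nw0 : 0 < nc (w - 1) by rewrite nc_gt0 subr_eq0.
have nwX s : nc (w ^+ s) = 1 by rewrite ncX nc_unit_root expr1n.
have nz s : nc (z s - c) = rho by rewrite nc_node // ltW.
have zmu_ge s : kap <= nc (z s - mu).
  by rewrite /kap lerBlDr -(nz s); exact: nc_distD.
have zmu_le s : nc (z s - mu) <= 2 * rho.
  apply: le_trans (nc_distD c _ _) _; rewrite nz mulr2n mulrDl mul1r.
  by rewrite lerD2l ncC ltW.
have zmu0 s : z s - mu != 0 by rewrite -nc_gt0; apply: lt_le_trans (zmu_ge s).
pose g s := rho%:C * w ^+ s / (z s - mu).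
have ng s : nc (g s) <= rho / kap.
  rewrite ncM ncM nwX mulr1 nc_real gtr0_norm // ncV ler_pM2l //.
  by rewrite lef_pV2 ?posrE // (lt_le_trans kap0).
pose a t s := mu + t%:C * (z s - mu).
pose phi t := N.+2%:R^-1 * \sum_(s < N.+2) (g s * h (a t s)).
have adisc t s : 0 <= t <= 1 -> nc (a t s - c) <= rho.
  case/andP=> t0 t1.
  have -> : a t s - c = (1 - t)%:C * (mu - c) + t%:C * (z s - c).
    by rewrite /a rmorphB rmorph1; ring.
  apply: le_trans (ncD _ _) _; rewrite !ncM !nc_real nz.
  rewrite !ger0_norm ?subr_ge0 //.
  have : (1 - t) * nc (mu - c) <= (1 - t) * rho.
    by rewrite ler_wpM2l ?subr_ge0 // ltW.
  by move=> h1; apply: le_trans (lerD h1 (lexx _)) _; rewrite -mulrDl subrK mul1r.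
have step t t' : 0 <= t <= 1 -> t' - t = K.+1%:R^-1 ->
    nc (phi t' - phi t) <= e / K.+1%:R.
  move=> t01 tt'.
  (* [D] is the linear part of the increment of [phi]: the weight [g s] times the velocity
     [z s - mu] is [rho * w ^+ s], so the Cauchy kernel cancels. *)
  pose D := \sum_(s < N.+2) (d (a t s) * (rho%:C * w ^+ s)).
  have nD : nc D <= N.+2%:R * (e1 * rho).
    (* For [t > 0], multiplication by [t * (w - 1)] turns the terms of [D] into linearized
       increments of [h] from [a t s] to [a t s.+1], and the true increments telescope to 0 around
       the circle. For [t = 0] all points are [mu] and the roots of unity sum to 0. *)
    case/andP: (t01) => t0 _; move: t0; rewrite le_eqVlt => /orP[/eqP t0|t0].
      rewrite /D (eq_bigr (fun s : 'I_N.+2 => d mu * rho%:C * w ^+ s)) => [|s _].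
        rewrite -mulr_sumr root_sum ?unit_root_pow // mulr0 nc0.
        by rewrite mulr_ge0 ?ler0n // mulr_ge0 // ltW.
      by rewrite /a -t0 rmorph0 mul0r addr0 mulrA.
    have tw0 : 0 < t * nc (w - 1) by rewrite mulr_gt0.
    rewrite -(ler_pM2r tw0).
    have tele : \sum_(s < N.+2) (h (a t s.+1) - h (a t s)) = 0.
      rewrite -(big_mkord xpredT (fun s => h (a t s.+1) - h (a t s))).
      rewrite telescope_sumr // /a /z /node.
      by rewrite unit_root_pow expr0 subrr.
    have da s : a t s.+1 - a t s = t%:C * (rho%:C * w ^+ s * (w - 1)).
      by rewrite /a /z /node -/w exprS; ring.
    have nda s : nc (a t s.+1 - a t s) = t * nc (w - 1) * rho.
      rewrite da !ncM nwX !nc_real !gtr0_norm //; ring.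
    have -> : nc D * (t * nc (w - 1)) = nc (\sum_(s < N.+2)
        (h (a t s.+1) - h (a t s) - d (a t s) * (a t s.+1 - a t s))).
      rewrite sumrB tele sub0r ncN -[t in LHS]gtr0_norm // -nc_real -!ncM.
      congr nc; rewrite /D mulr_suml; apply: eq_bigr => s _.
      by rewrite da; ring.
    apply: le_trans (nc_sum _ _ _) _.
    have -> : N.+2%:R * (e1 * rho) * (t * nc (w - 1)) =
        \sum_(s < N.+2) (e1 * (t * nc (w - 1) * rho)).
      by rewrite sumr_const card_ord -mulr_natl; ring.
    apply: ler_sum => s _; rewrite -(nda s); apply: hd; rewrite ?subrr ?nc0 //.
      exact: adisc.
    rewrite nda -ltr_pdivlMr //; apply: le_lt_trans hw.
    by rewrite ler_piMl ?nc_ge0 //; case/andP: t01.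
  have da s : a t' s - a t s = K.+1%:R^-1%:C * (z s - mu).
    by rewrite -tt' rmorphB /a; ring.
  have nda s : nc (a t' s - a t s) <= 2 * rho / K.+1%:R.
    rewrite da ncM nc_real gtr0_norm ?invr_gt0 ?ltr0n // mulrC.
    by rewrite ler_wpM2r ?invr_ge0.
  have -> : phi t' - phi t = N.+2%:R^-1 * (\sum_(s < N.+2) (g s *
      (h (a t' s) - h (a t s) - d (a t s) * (a t' s - a t s))))
      + N.+2%:R^-1 * (K.+1%:R^-1%:C * D).
    rewrite -mulrBr -mulrDr -sumrB; congr (_ * _).
    rewrite /D mulr_sumr -big_split /=; apply: eq_bigr => s _.
    rewrite da /g; move: (K.+1%:R^-1)%:C => y; field; exact: zmu0.
  have K0 : 0 < K.+1%:R :> R by rewrite ltr0n.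
  have N0' : 0 < N.+2%:R :> R by rewrite ltr0n.
  apply: le_trans (ncD _ _) _.
  have -> : e / K.+1%:R = (rho / kap) * (e1 * (2 * rho / K.+1%:R))
       + K.+1%:R^-1 * (e1 * rho).
    have -> : e = e1 * C by rewrite /e1 divfK // gt_eqF.
    rewrite /C; move: (K.+1%:R : R) K0 => y y0.
    by field; rewrite !gt_eqF.
  rewrite !ncM nc_real !ncV nc_nat; apply: lerD.
    rewrite mulrC ler_pdivrMr //; apply: le_trans (nc_sum _ _ _) _.
    rewrite mulr_natr -[X in _ *+ X]card_ord -sumr_const; apply: ler_sum => s _.
    rewrite ncM; apply: ler_pM; rewrite ?nc_ge0 //.
    apply: le_trans (hd _ (adisc t s t01) _ _ _ _) _; rewrite ?subrr ?nc0 //.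
      apply: le_lt_trans (nda s) _.
      by rewrite ltr_pdivrMr // [dl * _]mulrC -ltr_pdivrMr.
    by rewrite ler_pM2l.
  rewrite [`|_|]ger0_norm ?invr_ge0 // mulrCA ler_pM2l ?invr_gt0 //.
  by rewrite mulrC ler_pdivrMr // mulrC.
have -> : circle_mean c rho N (fun z => h z / (z - mu)) = phi 1.
  congr (_ * _); apply: eq_bigr => s _.
  by rewrite /a rmorph1 mul1r /g [mu + _]addrC subrK -/w -/(z s); ring.
have -> : h mu * circle_mean c rho N (fun z => (z - mu)^-1) = phi 0.
  rewrite mulrCA; congr (_ * _); rewrite mulr_sumr; apply: eq_bigr => s _.
  by rewrite /a rmorph0 mul0r /g addr0 -/w -/(z s); ring.
pose t q := q%:R / K.+1%:R : R.
have -> : phi 1 - phi 0 = \sum_(0 <= q < K.+1) (phi (t q.+1) - phi (t q)).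
  by rewrite (telescope_sumr (fun q => phi (t q))) // /t mul0r divff ?pnatr_eq0.
apply: le_trans (nc_sum _ _ _) _.
have -> : e = \sum_(0 <= q < K.+1) (e / K.+1%:R).
  by rewrite sumr_const_nat subn0 -mulrnAl -[_ *+ K.+1]mulr_natr mulfK ?pnatr_eq0.
apply: ler_sum_nat => q /andP[_ qK]; apply: step; rewrite /t.
  by rewrite divr_ge0 //= ler_pdivrMr // mul1r ler_nat ltnW.
by rewrite -mulrBl -natrB // subSnn mul1r.
Qed.

Lemma expr_cvg0 (x e : R) : 0 <= x -> x < 1 -> 0 < e ->
  exists N0, forall N, (N0 <= N)%N -> x ^+ N <= e.
Proof.
move=> x0 x1 e0; have : (fun n => x ^+ n) @ \oo --> (0 : R).
  by apply: cvg_expr; rewrite ger0_norm.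
move=> /cvgrPdist_le/(_ _ e0) [N0 _ h]; exists N0 => N /h /=.
by rewrite sub0r normrN ger0_norm // exprn_ge0.
Qed.

(** The mean is exactly [(1 - y)^-1] with [y = ((mu - c) / rho) ^+ N.+2], and [y] tends to 0. *)
Lemma circle_mean_kernel c rho mu : nc (mu - c) < rho -> forall e, 0 < e ->
  exists N0, forall N, (N0 <= N)%N ->
    nc (circle_mean c rho N (fun z => (z - mu)^-1) - 1) <= e.
Proof.
move=> hmu e e0; have rho0 : 0 < rho by apply: le_lt_trans hmu; rewrite nc_ge0.
set x := nc (mu - c) / rho.
have x0 : 0 <= x by rewrite divr_ge0 ?nc_ge0 // ltW.
have x1 : x < 1 by rewrite ltr_pdivrMr // mul1r.
(* The bound [1 / 2] on the modulus of [y] keeps that of [1 - y] above [1 / 2]; the bound [e / 2]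
   then gives [e] for the quotient. *)
have m0 : 0 < Num.min (1 / 2) (e / 2) by rewrite lt_min !divr_gt0.
have [N0 hN0] := expr_cvg0 x0 x1 m0; exists N0 => N N0N.
have := hN0 N.+2 (leq_trans N0N (leq_addl 2 N)); rewrite le_min => /andP[h1 h2].
set b := mu - c; set r := rho%:C.
have r0 : r != 0 by rewrite -nc_gt0 nc_real gtr0_norm.
have bx : nc ((b / r) ^+ N.+2) = x ^+ N.+2.
  by rewrite ncX ncM ncV nc_real gtr0_norm.
set y := (b / r) ^+ N.+2 in bx.
have y1 : 1 / 2 <= nc (1 - y).
  have := ncD (1 - y) y; rewrite subrK nc1 bx; lra.
have y0 : 1 - y != 0 by rewrite -nc_gt0 (lt_le_trans _ y1) // divr_gt0.
have br : r ^+ N.+2 - b ^+ N.+2 = r ^+ N.+2 * (1 - y).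
  by rewrite mulrBr mulr1 -exprMn mulrC divfK.
have rb : r ^+ N.+2 != b ^+ N.+2.
  by rewrite -subr_eq0 br mulf_neq0 // expf_neq0.
have -> : circle_mean c rho N (fun z => (z - mu)^-1) = (1 - y)^-1.
  rewrite /circle_mean.
  have := cauchy_kernel_sum (unit_root_pow R N) (@unit_root_prim R N) isT rb.
  under eq_bigr => s _ do rewrite /b opprB addrCA addrA -/(node c rho N s).
  move=> ->; rewrite br; field; rewrite y0 expf_neq0 //=.
  by rewrite -natrD pnatr_eq0.
have -> : (1 - y)^-1 - 1 = y / (1 - y) by field.
rewrite ncM ncV bx ler_pdivrMr ?nc_gt0 //.
apply: le_trans h2 _; rewrite ler_pM2l //; lra.
Qed.

Lemma circle_mean_cauchy h c rho mu : 0 < rho ->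
  (forall a, nc (a - c) <= rho -> strictly_diff h a) ->
  nc (mu - c) < rho -> forall e, 0 < e ->
  exists N0, forall N, (N0 <= N)%N ->
    nc (circle_mean c rho N (fun z => h z / (z - mu)) - h mu) <= e.
Proof.
move=> rho0 hsd hmu e e0; have e2 : 0 < e / 2 by rewrite divr_gt0.
have [N1 h1] := circle_mean_contract rho0 hsd hmu e2.
have hp : 0 < nc (h mu) + 1 by rewrite ltr_wpDl ?nc_ge0.
have [N2 h2] := circle_mean_kernel hmu (divr_gt0 e2 hp).
exists (maxn N1 N2) => N; rewrite geq_max => /andP[/h1 hN1 /h2 hN2].
apply: le_trans (nc_distD (h mu * circle_mean c rho N (fun z => (z - mu)^-1)) _ _) _.
rewrite [leRHS]splitr; apply: lerD => //.
rewrite -[X in _ - X]mulr1 -mulrBr ncM.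
apply: (@le_trans _ _ ((nc (h mu) + 1) * (e / 2 / (nc (h mu) + 1)))).
  by apply: ler_pM; rewrite ?nc_ge0 ?lerDl.
by rewrite mulrC divfK // gt_eqF.
Qed.

End DiscreteCauchy.

(** * Strict differentiability of C^1 functions *)

Section ComplexLimits.
Variable R : realType.

(** The topology of [R[i]^o] has its radii in [R[i]]. A positive element of [R[i]] is a positive
    real, so radii can be taken in [R] here and in the next lemmas. *)
Lemma cvgcP (T : Type) (F : set_system T) (FF : Filter F) (S : T -> R[i]^o)
    (d : R[i]) :
  S @ F --> (d : R[i]^o) <->
  (forall e : R, 0 < e -> \forall h \near F, nc (S h - d) <= e).
Proof.
rewrite cvgrPdist_le; split=> [h e e0|h [e1 e2]].
  have : 0 < e%:C :> R[i] by rewrite ltcR.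
  by move=> /h; apply: filterS => x; rewrite normrc lecR ncC.
rewrite ltcE /= => /andP[/eqP -> e0].
by apply: filterS (h _ e0) => x; rewrite normrc ncC -lecR.
Qed.

Lemma near_dnbhs0c (P : set R[i]^o) :
  (\forall h \near 0^', P h) <->
  exists2 dl : R, 0 < dl & forall h, h != 0 -> nc h < dl -> P h.
Proof.
split.
  move=> [[e1 e2] /=]; rewrite ltcE /= => /andP[/eqP -> e0] h.
  exists e1 => // x x0 xe; apply: h => //=.
  by rewrite sub0r normrN normrc ltcR.
move=> [dl dl0 h]; exists dl%:C => /=; first by rewrite ltcR.
by move=> x /=; rewrite sub0r normrN normrc ltcR => xd x0; apply: h.
Qed.

Lemma nbhscP (a : R[i]^o) (P : set R[i]^o) :
  nbhs a P <-> exists2 dl : R, 0 < dl & forall z, nc (z - a) < dl -> P z.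
Proof.
split.
  rewrite -nbhs_ballE => -[[e1 e2] /=]; rewrite ltcE /= => /andP[/eqP -> e0] h.
  by exists e1 => // z za; apply: h; rewrite /ball /= normrc ltcR ncC.
move=> [dl dl0 h]; rewrite -nbhs_ballE; exists dl%:C => /=; first by rewrite ltcR.
by move=> x /=; rewrite /ball /= normrc ltcR ncC => /h.
Qed.

Lemma cderivableP (f : R[i]^o -> R[i]^o) z d :
  (derivable f z 1 /\ derive1 f z = d) <->
  (forall e : R, 0 < e -> \forall h \near (0 : R[i]^o)^',
     nc (h^-1 * (f (h + z) - f z) - d) <= e).
Proof.
rewrite -cvgcP.
have E : (fun h : R[i]^o => h^-1 *: ((f \o shift z) (h *: 1) - f z)) =
    (fun h : R[i]^o => h^-1 * (f (h + z) - f z)).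
  by apply: funext => h /=; rewrite /GRing.scale /= mulr1.
rewrite derive1E /derivable /derive E; split=> [[h <-] //|h].
by split; [apply/cvg_ex; exists d | apply: cvg_lim].
Qed.

Lemma rderivableP (g : R -> R) t l :
  (forall e : R, 0 < e -> exists2 dl : R, 0 < dl &
     forall h, `|h| < dl -> `|g (t + h) - g t - l * h| <= e * `|h|) ->
  is_derive t 1 g l.
Proof.
move=> hg; have E : (fun h : R => h^-1 *: ((g \o shift t) (h *: 1) - g t)) =
    (fun h : R => h^-1 * (g (h + t) - g t)).
  by apply: funext => h /=; rewrite /GRing.scale /= mulr1.
have : (fun h : R => h^-1 * (g (h + t) - g t)) @ 0^' --> l.
  apply/cvgrPdist_le => e /hg [dl dl0 h]; exists dl => //= x /=.
  rewrite sub0r normrN => xd x0.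
  rewrite distrC -(ler_pM2r (_ : 0 < `|x|)) ?normr_gt0 // -normrM.
  apply: le_trans (h x xd); rewrite addrC [t + x]addrC le_eqVlt.
  by apply/orP; left; apply/eqP; congr `|_|; field.
by rewrite -E => h; apply: DeriveDef; [apply/cvg_ex; exists l | apply: cvg_lim].
Qed.

End ComplexLimits.

Section StrictDifferentiability.
Variable R : realType.
Implicit Types (h : R[i] -> R[i]) (a c mu : R[i]).

Lemma strictly_diff_lip h a : strictly_diff h a ->
  exists (C dl : R), [/\ 0 < C, 0 < dl & forall u, nc (u - a) < dl ->
    nc (h u - h a) <= C * nc (u - a)].
Proof.
move=> [d /(_ 1 ltr01) [dl dl0 hd]]; exists (nc d + 1), dl.
split=> // [|u ua]; first by rewrite ltr_wpDl ?nc_ge0.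
have := hd a u; rewrite subrr nc0 => /(_ dl0 ua); rewrite mul1r => h1.
rewrite -[h u - h a](subrK (d * (u - a))); apply: le_trans (ncD _ _) _.
by rewrite ncM mulrDl mul1r addrC lerD2l.
Qed.

(** Compactness by ultralimits again: at the ultralimit of points [a N] with [h (a N)] larger than
    [N], the local Lipschitz bound would be violated. *)
Lemma strictly_diff_bounded h c rho :
  (forall a, nc (a - c) <= rho -> strictly_diff h a) ->
  cbounded [set a | nc (a - c) <= rho] h.
Proof.
move=> hsd; apply: contrapT => hn.
have /choice [a ha] : forall N : nat, exists a, nc (a - c) <= rho /\
    N%:R < nc (h a).
  move=> N; apply: contrapT => hN; apply: hn; exists N%:R => a /= ac.
  by rewrite leNgt; apply/negP => hl; apply: hN; exists a.
have ab : cbounded setT a.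
  exists (rho + nc c) => N _; rewrite -[a N](subrK c).
  by apply: le_trans (ncD _ _) _; rewrite lerD2r; case: (ha N).
have ac : nc (culim a - c) <= rho.
  apply/ler_addgt0Pr => e' e'0.
  have [i /= hi] := filter_ex (culimP ab e'0).
  apply: le_trans (nc_distD (a i) _ _) _.
  by rewrite addrC; apply: lerD; [case: (ha i) | rewrite ncC].
have [C [dl [C0 dl0 hC]]] := strictly_diff_lip (hsd _ ac).
have dl2 : 0 < dl / 2 by rewrite divr_gt0.
set B := nc (h (culim a)) + C * dl.
have B0 : 0 <= B by rewrite addr_ge0 ?nc_ge0 // mulr_ge0 // ltW.
have hU : ultra_nat [set i | (Num.bound B <= i)%N].
  by apply: ultra_nat_oo; exists (Num.bound B).
have [i [/= hi N0i]] := filter_ex (filterI (culimP ab dl2) hU).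
have [_] := ha i; apply/negP; rewrite -leNgt.
have hidl : nc (a i - culim a) < dl.
  by apply: le_lt_trans hi _; rewrite ltr_pdivrMr // ltr_pMr // ltr1n.
have h1 := hC _ hidl.
apply: (@le_trans _ _ B).
  rewrite -[h (a i)](subrK (h (culim a))); apply: le_trans (ncD _ _) _.
  rewrite addrC lerD2l; apply: le_trans h1 _.
  by rewrite ler_pM2l // ltW.
by apply: ltW; apply: lt_le_trans (archi_boundP B0) _; rewrite ler_nat.
Qed.

Lemma strictly_diffM h1 h2 a : strictly_diff h1 a -> strictly_diff h2 a ->
  strictly_diff (fun z => h1 z * h2 z) a.
Proof.
move=> s1 s2; have [C1 [l1 [C10 l10 L1]]] := strictly_diff_lip s1.
have [C2 [l2 [C20 l20 L2]]] := strictly_diff_lip s2.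
case: s1 s2 => [d1 S1] [d2 S2]; exists (d1 * h2 a + h1 a * d2) => e e0.
(* [K] adds up the coefficients of the four error terms in the decomposition of the product
   increment; the final 1 makes it positive. *)
set K := nc (h2 a) + C2 + nc d1 * C2 + nc (h1 a) + C1 + C1 * nc d2 + 1.
have K1 : 0 < K.
  by rewrite ltr_wpDl // !addr_ge0 ?mulr_ge0 ?nc_ge0 // ltW.
have eK : 0 < e / K by rewrite divr_gt0.
have [r1 r10 T1] := S1 _ eK; have [r2 r20 T2] := S2 _ eK.
set dl := Num.min (Num.min (Num.min l1 l2) (Num.min r1 r2))
            (Num.min 1 (e / K)).
have dl0 : 0 < dl by rewrite !lt_min l10 l20 r10 r20 ltr01 eK.
exists dl => // u v.
rewrite !lt_min => /andP[/andP[/andP[u1 u2] /andP[u3 u4]] /andP[u5 u6]].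
move=> /andP[/andP[/andP[v1 v2] /andP[v3 v4]] /andP[v5 v6]].
have -> : h1 v * h2 v - h1 u * h2 u - (d1 * h2 a + h1 a * d2) * (v - u) =
  (h1 v - h1 u - d1 * (v - u)) * h2 v + d1 * (v - u) * (h2 v - h2 a) +
  h1 u * (h2 v - h2 u - d2 * (v - u)) + (h1 u - h1 a) * d2 * (v - u) by ring.
have A1 := T1 _ _ u3 v3; have A2 := T2 _ _ u4 v4.
have B1 := L1 _ u1; have B2 := L2 _ v2.
have w0 := nc_ge0 (v - u).
have b2 : nc (h2 v - h2 a) <= C2 * (e / K).
  by apply: le_trans B2 _; rewrite ler_pM2l // ltW.
have b1 : nc (h1 u - h1 a) <= C1 * (e / K).
  by apply: le_trans B1 _; rewrite ler_pM2l // ltW.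
have bb2 : nc (h2 v) <= nc (h2 a) + C2.
  rewrite -[h2 v](subrK (h2 a)); apply: le_trans (ncD _ _) _.
  rewrite addrC lerD2l; apply: le_trans B2 _.
  by rewrite ler_piMr // ltW.
have bb1 : nc (h1 u) <= nc (h1 a) + C1.
  rewrite -[h1 u](subrK (h1 a)); apply: le_trans (ncD _ _) _.
  rewrite addrC lerD2l; apply: le_trans B1 _.
  by rewrite ler_piMr // ltW.
set E := e / K in eK A1 A2 b1 b2 *.
have -> : e = E * K by rewrite /E divfK // gt_eqF.
set w := nc (v - u) in w0 A1 A2 *.
apply: (@le_trans _ _ (E * w * (nc (h2 a) + C2) + nc d1 * w * (C2 * E) +
   (nc (h1 a) + C1) * (E * w) + C1 * E * nc d2 * w)).
  apply: le_trans (ncD _ _) _; apply: lerD.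
    apply: le_trans (ncD _ _) _; apply: lerD.
      apply: le_trans (ncD _ _) _; apply: lerD; rewrite !ncM.
        by apply: ler_pM => //; exact: nc_ge0.
      by apply: ler_pM => //; rewrite ?mulr_ge0 ?nc_ge0.
    by rewrite ncM; apply: ler_pM => //; exact: nc_ge0.
  by rewrite !ncM ler_wpM2r // ler_wpM2r // nc_ge0.
rewrite -subr_ge0 /K (_ : _ - _ = E * w); last by ring.
by rewrite mulr_ge0 // ltW.
Qed.

Lemma strictly_diff_sub c a : strictly_diff (fun z => z - c) a.
Proof.
exists 1 => e e0; exists 1 => // u v _ _.
rewrite /= mul1r; have -> : v - c - (u - c) - (v - u) = 0 by ring.
by rewrite nc0 mulr_ge0 ?nc_ge0 ?ltW.
Qed.

Lemma strictly_diff_inv mu a : a != mu -> strictly_diff (fun z => (z - mu)^-1) a.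
Proof.
move=> am; set k := nc (a - mu).
have k0 : 0 < k by rewrite nc_gt0 subr_eq0.
exists (- (a - mu)^-1 ^+ 2) => e e0.
(* [k / 2] keeps [u] and [v] at distance at least [k / 2] from [mu]; with [e * k ^+ 3 / 8] the
   remainder is at most [3 / 4 * e] times the modulus of [v - u]. *)
set dl := Num.min (k / 2) (e * k ^+ 3 / 8).
have dl0 : 0 < dl by rewrite lt_min !divr_gt0 // mulr_gt0 ?exprn_gt0.
exists dl => // u v; rewrite !lt_min => /andP[u1 u2] /andP[v1 v2].
have far x : nc (x - a) < k / 2 -> k / 2 <= nc (x - mu).
  by have := nc_distD x a mu; rewrite (ncC a x) -/k; lra.
have ku := far _ u1; have kv := far _ v1.
have k20 : 0 < k / 2 by rewrite divr_gt0.
have u0 : u - mu != 0 by rewrite -nc_gt0 (lt_le_trans k20).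
have v0 : v - mu != 0 by rewrite -nc_gt0 (lt_le_trans k20).
have a0 : a - mu != 0 by rewrite -nc_gt0.
have -> : (v - mu)^-1 - (u - mu)^-1 - - (a - mu)^-1 ^+ 2 * (v - u) =
   (v - u) * ((a - mu)^-1 * ((v - a) * (v - mu)^-1 * (a - mu)^-1
      + (v - mu)^-1 * (u - a) * (u - mu)^-1)).
  by field; rewrite v0 u0 a0.
rewrite ncM mulrC ler_wpM2r ?nc_ge0 // ncM ncV -/k.
apply: (@le_trans _ _ (k^-1 * ((e * k ^+ 3 / 8) * (k / 2)^-1 * k^-1 +
     (k / 2)^-1 * (e * k ^+ 3 / 8) * (k / 2)^-1))).
  rewrite ler_pM2l ?invr_gt0 //; apply: le_trans (ncD _ _) _.
  have iv : nc (v - mu)^-1 <= (k / 2)^-1.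
    by rewrite ncV lef_pV2 ?posrE // nc_gt0.
  have iu : nc (u - mu)^-1 <= (k / 2)^-1.
    by rewrite ncV lef_pV2 ?posrE // nc_gt0.
  rewrite !ncM; apply: lerD.
    rewrite [nc (a - mu)^-1]ncV -/k; apply: ler_wpM2r.
      by rewrite invr_ge0 ltW.
    by apply: ler_pM; rewrite ?nc_ge0 // ltW.
  apply: ler_pM; rewrite ?mulr_ge0 ?nc_ge0 //.
  by apply: ler_pM; rewrite ?nc_ge0 // ltW.
rewrite (_ : k^-1 * (_ + _) = e * (3 / 4)); last by field; rewrite gt_eqF.
by rewrite ler_piMr ?(ltW e0) //; lra.
Qed.

Section MeanValue.
Variables (f : R[i]^o -> R[i]^o).

(** The mean value equality fails for complex values, so the real one is applied along the segment
    to a real part, after multiplication by a unit [k]. The choices 1 and ['i] of [k] recover the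
    real and the imaginary part, whence the factor 2 in [mean_value]. *)
Lemma mean_value_Re (u v d : R[i]) (e : R) :
  (forall t : R, 0 <= t <= 1 -> derivable f (u + t%:C * (v - u)) 1 /\
     nc (derive1 f (u + t%:C * (v - u)) - d) <= e) ->
  forall k : R[i], nc k = 1 ->
  `|complex.Re (k * (f v - f u - d * (v - u)))| <= e * nc (v - u).
Proof.
move=> hf k k1; pose p (t : R) := u + t%:C * (v - u).
pose g (t : R) := complex.Re (k * (f (p t) - d * (t%:C * (v - u)))).
pose dg (t : R) := complex.Re (k * ((derive1 f (p t) - d) * (v - u))).
have hg (t : R) : 0 <= t <= 1 -> is_derive t (1 : R) g (dg t).
  move=> t01; apply: rderivableP => e1 e10.
  have hd := (@cderivableP R f (p t) (derive1 f (p t))).1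
    (conj (hf t t01).1 erefl).
  (* The length of the segment may be 0; adding 1 allows division by it. *)
  have w1 : 0 < nc (v - u) + 1 by rewrite ltr_wpDl ?nc_ge0.
  have /near_dnbhs0c [dl dl0 hdl] := hd _ (divr_gt0 e10 w1).
  exists (dl / (nc (v - u) + 1)); first by rewrite divr_gt0.
  move=> h hdlt.
  set x := h%:C * (v - u).
  have nx : nc x = `|h| * nc (v - u) by rewrite ncM nc_real.
  have xlt : nc x < dl.
    rewrite nx; apply: le_lt_trans (_ : `|h| * (nc (v - u) + 1) < dl).
      by rewrite ler_wpM2l // lerDl.
    by rewrite -ltr_pdivlMr.
  have pth : p (t + h) = x + p t by rewrite /p /x rmorphD; ring.
  have -> : g (t + h) - g t - dg t * h =
     complex.Re (k * (f (x + p t) - f (p t) - derive1 f (p t) * x)).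
    rewrite /g /dg -!raddfB pth.
    rewrite -[X in _ - X](_ : complex.Re (k * ((derive1 f (p t) - d) * x)) = _).
      by rewrite -raddfB /x rmorphD; congr complex.Re; ring.
    set y := k * (_ * (v - u)).
    have -> : k * ((derive1 f (p t) - d) * x) = y * h%:C by rewrite /y /x; ring.
    by case: y => y1 y2 /=; rewrite mulr0 subr0.
  apply: le_trans (normr_Re_le _) _; rewrite ncM k1 mul1r.
  have [->|x0] := eqVneq x 0.
    by rewrite mulr0 add0r subrr subr0 nc0 mulr_ge0 // ltW.
  have := hdl x x0 xlt.
  rewrite -(ler_pM2r (_ : 0 < nc x)) ?nc_gt0 // -ncM => h1.
  rewrite (_ : _ - _ = (x^-1 * (f (x + p t) - f (p t)) - derive1 f (p t)) * x);
    last by field.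
  apply: le_trans h1 _; rewrite nx.
  rewrite (_ : _ / _ * _ = (e1 * `|h|) * (nc (v - u) / (nc (v - u) + 1)));
    last by field; rewrite gt_eqF.
  rewrite ler_piMr ?mulr_ge0 ?(ltW e10) // ler_pdivrMr // mul1r lerDl.
  exact: ler01.
have [x xI hx] : exists2 c : R, c \in `[0, 1] & g 1 - g 0 = dg c * (1 - 0).
  apply: MVT_segment => // [x xI|].
    by apply: hg; move: xI; rewrite in_itv /= => /andP[/ltW -> /ltW ->].
  apply: derivable_within_continuous => x; rewrite in_itv /= => /hg hx.
  by case: hx.
have -> : complex.Re (k * (f v - f u - d * (v - u))) = g 1 - g 0.
  rewrite /g -raddfB; congr complex.Re.
  by rewrite /p rmorph1 rmorph0 !mul0r mul1r addr0 [u + _]addrC subrK; ring.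
rewrite hx subr0 mulr1; apply: le_trans (normr_Re_le _) _.
rewrite !ncM k1 mul1r ler_wpM2r ?nc_ge0 //.
by have [] := hf x; rewrite // in_itv /= in xI.
Qed.

Lemma mean_value (u v d : R[i]) (e : R) :
  (forall t : R, 0 <= t <= 1 -> derivable f (u + t%:C * (v - u)) 1 /\
     nc (derive1 f (u + t%:C * (v - u)) - d) <= e) ->
  nc (f v - f u - d * (v - u)) <= 2 * e * nc (v - u).
Proof.
move=> h; apply: le_trans (nc_le_ReIm _) _.
rewrite -mulrA mulr2n mulrDl mul1r; apply: lerD.
  by have := mean_value_Re h (nc1 R); rewrite mul1r.
have ni : nc ('i%C : R[i]) = 1 by rewrite /Normc.normc /= expr0n expr1n add0r sqrtr1.
have := mean_value_Re h ni.
by rewrite mulrC ReiNIm normrN.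
Qed.

Lemma strictly_diff_of_C1 (Omega : set R[i]^o) : open Omega ->
  (forall z, Omega z -> derivable f z 1) ->
  (forall z, Omega z -> {for z, continuous (derive1 f)}) ->
  forall a, Omega a -> strictly_diff f a.
Proof.
move=> Oo df cf a Oa; exists (derive1 f a) => e e0.
have e2 : 0 < e / 2 by rewrite divr_gt0.
have /nbhscP [d1 d10 h1] : nbhs (a : R[i]^o) Omega by exact: open_nbhs_nbhs.
have /cvgcP/(_ _ e2)/nbhscP [d2 d20 h2] := cf a Oa.
exists (Num.min d1 d2); first by rewrite lt_min d10.
move=> u v ua va; have -> : e = 2 * (e / 2) by field.
apply: mean_value => t /andP[t0 t1].
have : nc (u + t%:C * (v - u) - a) < Num.min d1 d2.
  rewrite (_ : _ - a = (1 - t)%:C * (u - a) + t%:C * (v - a)); last first.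
    by rewrite rmorphB rmorph1; ring.
  apply: le_lt_trans (ncD _ _) _; rewrite !ncM !nc_real.
  rewrite !ger0_norm ?subr_ge0 //; move: ua va; set m := Num.min d1 d2.
  set x := nc _; set y := nc _ => xm ym.
  apply: (@le_lt_trans _ _ (Num.max x y)); last by rewrite gt_max xm.
  have : x <= Num.max x y by rewrite le_max lexx.
  have : y <= Num.max x y by rewrite le_max lexx orbT.
  by move: (Num.max x y) => M yM xM; nra.
by rewrite lt_min => /andP[/h1 /df ? /h2].
Qed.

End MeanValue.
End StrictDifferentiability.

(** * The contour functional *)

Section UniformConvergence.
Variables (R : realType) (T : Type) (F : set_system T).
Context {FF : ProperFilter F}.
Variable G : set R[i].
Implicit Types (S : T -> R[i] -> R[i]) (D : R[i] -> R[i]).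

Lemma cbounded_cst (c : R[i]) : cbounded G (fun=> c).
Proof. by exists (nc c). Qed.

Lemma cboundedD D1 D2 : cbounded G D1 -> cbounded G D2 ->
  cbounded G (fun z => D1 z + D2 z).
Proof.
move=> [M1 h1] [M2 h2]; exists (M1 + M2) => z Gz.
by apply: le_trans (ncD _ _) _; rewrite lerD ?h1 ?h2.
Qed.

Lemma cboundedM D1 D2 : cbounded G D1 -> cbounded G D2 ->
  cbounded G (fun z => D1 z * D2 z).
Proof.
move=> [M1 h1] [M2 h2]; exists (M1 * M2) => z Gz.
by rewrite ncM ler_pM ?nc_ge0 ?h1 ?h2.
Qed.

Lemma cboundedX D p : cbounded G D -> cbounded G (fun z => D z ^+ p).
Proof.
move=> bD; elim: p => [|p IHp]; first exact: cbounded_cst.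
by under eq_fun do rewrite exprS; exact: cboundedM.
Qed.

Lemma cbounded_sum I (s : seq I) (P : pred I) (D : I -> R[i] -> R[i]) :
  (forall i, P i -> cbounded G (D i)) ->
  cbounded G (fun z => \sum_(i <- s | P i) D i z).
Proof.
move=> bD; elim: s => [|i s IHs].
  by under eq_fun do rewrite big_nil; exact: cbounded_cst.
under eq_fun do rewrite big_cons; have [Pi|//] := boolP (P i).
exact: cboundedD (bD _ Pi) IHs.
Qed.

Lemma eq_cbounded D1 D2 : (forall z, G z -> D1 z = D2 z) ->
  cbounded G D1 -> cbounded G D2.
Proof. by move=> e [M h]; exists M => z Gz; rewrite -e ?h. Qed.

(** The limit is required to be bounded because products of uniformly convergent families need
    it. *)
Definition ucvg S D := cbounded G D /\
  forall e : R, 0 < e -> \forall h \near F, forall z, G z -> nc (S h z - D z) <= e.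

Lemma ucvg_cst D : cbounded G D -> ucvg (fun=> D) D.
Proof.
move=> bD; split=> // e e0; apply: filterE => h z _.
by rewrite subrr nc0 ltW.
Qed.

Lemma ucvg_near_bounded S D : ucvg S D ->
  exists M, \forall h \near F, forall z, G z -> nc (S h z) <= M.
Proof.
move=> [[M hM] hS]; exists (1 + M); apply: filterS (hS 1 ltr01) => h hh z Gz.
rewrite -[S h z](subrK (D z)); apply: le_trans (ncD _ _) _.
by rewrite lerD ?hh ?hM.
Qed.

Lemma ucvgD S1 D1 S2 D2 : ucvg S1 D1 -> ucvg S2 D2 ->
  ucvg (fun h z => S1 h z + S2 h z) (fun z => D1 z + D2 z).
Proof.
move=> [b1 h1] [b2 h2]; split; first exact: cboundedD.
move=> e e0; have e2 : 0 < e / 2 by rewrite divr_gt0.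
apply: filterS2 (h1 _ e2) (h2 _ e2) => h hh1 hh2 z Gz.
rewrite opprD addrACA; apply: le_trans (ncD _ _) _; rewrite [leRHS]splitr.
by rewrite lerD ?hh1 ?hh2.
Qed.

Lemma ucvgM S1 D1 S2 D2 : ucvg S1 D1 -> ucvg S2 D2 ->
  ucvg (fun h z => S1 h z * S2 h z) (fun z => D1 z * D2 z).
Proof.
move=> u1 u2; have [M nM] := ucvg_near_bounded u1.
case: u1 u2 => [[M1 b1] h1] [[M2 b2] h2]; split.
  by apply: cboundedM; [exists M1 | exists M2].
move=> e e0; set K := `|M| + `|M2| + 1.
have K0 : 0 < K by rewrite ltr_wpDl // addr_ge0.
have eK : 0 < e / K by rewrite divr_gt0.
near=> h => z Gz.
have -> : S1 h z * S2 h z - D1 z * D2 z =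
  S1 h z * (S2 h z - D2 z) + (S1 h z - D1 z) * D2 z by ring.
apply: (@le_trans _ _ (`|M| * (e / K) + e / K * `|M2|)).
  apply: le_trans (ncD _ _) _; rewrite !ncM; apply: lerD.
    apply: ler_pM; rewrite ?nc_ge0 //; last by move: z Gz; near: h; exact: h2.
    apply: le_trans (ler_norm _); move: z Gz; near: h; exact: nM.
  apply: ler_pM; rewrite ?nc_ge0 //; first by move: z Gz; near: h; exact: h1.
  by apply: le_trans (ler_norm _); exact: b2.
have E : e = e / K * K by rewrite divfK // gt_eqF.
by rewrite [leRHS]E mulrC -mulrDr ler_pM2l // lerDl.
Unshelve. all: by end_near. Qed.

Lemma ucvgX S D p : ucvg S D ->
  ucvg (fun h z => S h z ^+ p) (fun z => D z ^+ p).
Proof.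
move=> uS; elim: p => [|p IHp]; first by exact: ucvg_cst (cbounded_cst 1).
rewrite (_ : (fun h z => _) = (fun h z => S h z * S h z ^+ p)).
  rewrite (_ : (fun z => _) = (fun z => D z * D z ^+ p)); first exact: ucvgM.
  by apply: funext => z; rewrite exprS.
by apply: funext => h; apply: funext => z; rewrite exprS.
Qed.

Lemma ucvg_sum I (s : seq I) (S : I -> T -> R[i] -> R[i])
    (D : I -> R[i] -> R[i]) :
  (forall i, ucvg (S i) (D i)) ->
  ucvg (fun h z => \sum_(i <- s) S i h z) (fun z => \sum_(i <- s) D i z).
Proof.
move=> uS; elim: s => [|i s IHs].
  rewrite (_ : (fun h z => _) = (fun h z => 0)).
    rewrite (_ : (fun z => _) = (fun z => 0)).
      by exact: ucvg_cst (cbounded_cst 0).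
    by apply: funext => z; rewrite big_nil.
  by apply: funext => h; apply: funext => z; rewrite big_nil.
rewrite (_ : (fun h z => _) = (fun h z => S i h z + \sum_(j <- s) S j h z)).
  rewrite (_ : (fun z => _) = (fun z => D i z + \sum_(j <- s) D j z)).
    exact: ucvgD.
  by apply: funext => z; rewrite big_cons.
by apply: funext => h; apply: funext => z; rewrite big_cons.
Qed.

Lemma eq_ucvg S1 S2 D1 D2 :
  (\forall h \near F, forall z, G z -> S1 h z = S2 h z) ->
  (forall z, G z -> D1 z = D2 z) -> ucvg S1 D1 -> ucvg S2 D2.
Proof.
move=> eS eD [b1 h1]; split; first exact: eq_cbounded b1.
move=> e e0; apply: filterS2 eS (h1 e e0) => h hh1 hh2 z Gz.
by rewrite -hh1 // -eD // hh2.
Qed.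

Lemma ucvg_indep (s : T -> R[i]) d :
  (forall e : R, 0 < e -> \forall h \near F, nc (s h - d) <= e) ->
  ucvg (fun h _ => s h) (fun=> d).
Proof.
move=> hs; split; first exact: cbounded_cst.
by move=> e e0; apply: filterS (hs e e0).
Qed.

End UniformConvergence.

(** * Bounded functionals on a contour and their values on poles *)

Section ContourFunctional.
Variable R : realType.

(** The properties of contour integration that the rest relies on, apart from the values on poles.
    Linearity is asked of bounded functions only, since ultralimits are controlled only for bounded
    sequences. *)
Record bounded_functional (G : set R[i]) (L : (R[i] -> R[i]) -> R[i]) : Prop :=
  BoundedFunctional {
  bf_ext : forall phi psi, (forall z, G z -> phi z = psi z) -> L phi = L psi;
  bf_add : forall phi psi, cbounded G phi -> cbounded G psi ->
    L (fun z => phi z + psi z) = L phi + L psi;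
  bf_scale : forall a phi, cbounded G phi -> L (fun z => a * phi z) = a * L phi;
  bf_bound : exists2 C : R, 0 < C & forall phi M,
    0 <= M -> (forall z, G z -> nc (phi z) <= M) -> nc (L phi) <= C * M }.

Section Theory.
Variables (G : set R[i]) (L : (R[i] -> R[i]) -> R[i]).
Hypothesis bfL : bounded_functional G L.

Lemma bf0 : L (fun=> 0) = 0.
Proof.
have := bf_scale bfL 0 (cbounded_cst G 0).
by under eq_fun do rewrite mul0r; rewrite mul0r.
Qed.

Lemma bf_sum I (s : seq I) (phi : I -> R[i] -> R[i]) :
  (forall i, cbounded G (phi i)) ->
  L (fun z => \sum_(i <- s) phi i z) = \sum_(i <- s) L (phi i).
Proof.
move=> bphi; elim: s => [|i s IHs].
  by under eq_fun do rewrite big_nil; rewrite big_nil bf0.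
under eq_fun do rewrite big_cons; rewrite (bf_add bfL) ?IHs ?big_cons //.
by apply: cbounded_sum.
Qed.

Lemma bf_sub phi psi : cbounded G phi -> cbounded G psi ->
  L (fun z => phi z - psi z) = L phi - L psi.
Proof.
move=> b1 b2; have b3 := cboundedM (cbounded_cst G (-1)) b2.
rewrite (bf_ext bfL (psi := fun z => phi z + -1 * psi z)) => [|z _].
  by rewrite (bf_add bfL) // (bf_scale bfL) // mulN1r.
by rewrite mulN1r.
Qed.

(** Exchanges the functional with limits, in particular with derivatives in a parameter. *)
Lemma bf_cvg (T : Type) (F : set_system T) {FF : ProperFilter F}
    (S : T -> R[i] -> R[i]) D : ucvg F G S D ->
  forall e : R, 0 < e -> \forall h \near F, nc (L (S h) - L D) <= e.
Proof.
move=> uS e e0; have [C C0 hC] := bf_bound bfL.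
have eC : 0 < e / C by rewrite divr_gt0.
have [M nM] := ucvg_near_bounded uS; case: uS => bD /(_ _ eC) hS.
apply: filterS2 nM hS => h hM hh.
have bS : cbounded G (S h) by exists M.
rewrite -bf_sub //; apply: le_trans (hC _ (e / C) (ltW eC) hh) _.
by rewrite mulrC divfK // gt_eqF.
Qed.

End Theory.

Lemma uniform_radius (T : eqType) (s : seq T) (P : T -> R -> Prop) :
  (forall x r r', P x r -> 0 < r' -> r' <= r -> P x r') ->
  (forall x, x \in s -> exists2 r, 0 < r & P x r) ->
  exists2 r, 0 < r & forall x, x \in s -> P x r.
Proof.
move=> Pmono; elim: s => [|x s IHs] hs; first by exists 1.
have [r1 r10 h1] := hs x (mem_head _ _).
have [|r2 r20 h2] := IHs; first by move=> y ys; apply: hs; rewrite inE ys orbT.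
have m0 : 0 < Num.min r1 r2 by rewrite lt_min r10.
exists (Num.min r1 r2) => // y; rewrite inE => /orP[/eqP ->|/h2 h].
  by apply: Pmono h1 _ _; rewrite // ge_min lexx.
by apply: Pmono h _ _; rewrite // ge_min lexx orbT.
Qed.

Section Construction.
Variables (f : R[i]^o -> R[i]^o) (cs : seq R[i]) (rho : R).
Hypothesis rho0 : 0 < rho.
Hypothesis cs_uniq : uniq cs.
Hypothesis f_sd : forall c, c \in cs -> forall a, nc (a - c) <= rho ->
  strictly_diff f a.
(** With the factor 4, a point within [rho / 2] of one center lies outside the closed disc of radius
    [rho] around any other center. *)
Hypothesis cs_sep : forall c c', c \in cs -> c' \in cs -> c != c' ->
  4 * rho <= nc (c - c').

Let G : set R[i] := [set z | exists2 c, c \in cs & nc (z - c) = rho].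
(** Poles stay within half the radius, so that the Cauchy kernels are bounded on [G] uniformly in
    the pole. *)
Let U : set R[i] := [set mu | exists2 c, c \in cs & nc (mu - c) < rho / 2].
Let L (phi : R[i] -> R[i]) : R[i] :=
  \sum_(c <- cs) culim (fun N => circle_mean c rho N (fun z => f z * phi z)).

Lemma node_contour c N s : c \in cs -> G (node c rho N s).
Proof. by move=> cc; exists c => //; rewrite nc_node // ltW. Qed.

Lemma circle_mean_le c N (phi : R[i] -> R[i]) M :
  (forall s, nc (phi (node c rho N s)) <= M) ->
  nc (circle_mean c rho N phi) <= rho * M.
Proof.
move=> hM; rewrite /circle_mean ncM ncV nc_nat mulrC ler_pdivrMr ?ltr0n //.
apply: le_trans (nc_sum _ _ _) _.
rewrite mulr_natr -[X in _ *+ X]card_ord -sumr_const; apply: ler_sum => s _.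
rewrite !ncM ncX nc_unit_root expr1n mulr1 nc_real gtr0_norm //.
by rewrite ler_pM2l.
Qed.

Lemma f_bounded_contour : cbounded G f.
Proof.
have : forall c, c \in cs -> cbounded [set a | nc (a - c) <= rho] f.
  by move=> c /f_sd; exact: strictly_diff_bounded.
rewrite /G; elim: cs => [|c s IHs] hs; first by exists 0 => z [].
have [M1 h1] := hs c (mem_head _ _).
have [|M2 h2] := IHs; first by move=> y ys; apply: hs; rewrite inE ys orbT.
exists (Num.max M1 M2) => z [c']; rewrite inE => /orP[/eqP -> zc|c's zc].
  by rewrite le_max h1 //= zc.
by rewrite le_max [X in _ || X]h2 ?orbT //; exists c'.
Qed.

Lemma circle_mean_cbounded c phi : c \in cs -> cbounded G phi ->
  cbounded setT (fun N => circle_mean c rho N (fun z => f z * phi z)).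
Proof.
move=> cc bphi; have [M hM] := cboundedM f_bounded_contour bphi.
by exists (rho * M) => N _; apply: circle_mean_le => s; apply: hM; exact: node_contour.
Qed.

Lemma contour_sep z mu : G z -> U mu -> rho / 2 <= nc (z - mu).
Proof.
move=> [c cc zc] [c' cc' mc']; have [E|ne] := eqVneq c c'.
  have := nc_distD mu z c; rewrite zc E; lra.
have := cs_sep cc cc' ne.
have := nc_distD mu c c'; have := nc_distD z c mu.
by rewrite (ncC c z) zc; have := rho0; lra.
Qed.

(* The circles not surrounding mu contribute nothing: apply the mean value
   property to f z * (z - c) / (z - mu), which vanishes at c. *)
Lemma contour_cauchy mu : U mu -> L (fun z => (z - mu)^-1) = f mu.
Proof.
move=> Umu; have bmu : cbounded G (fun z => (z - mu)^-1).
  exists (rho / 2)^-1 => z Gz; have h := contour_sep Gz Umu.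
  by rewrite ncV lef_pV2 ?posrE // ?(lt_le_trans _ h) // divr_gt0.
have [c cc mc] := Umu.
rewrite /L (bigD1_seq c) //= big_seq_cond big1 ?addr0 => [|c' /andP[cc' ne]].
  apply: culim_cvg; first exact: circle_mean_cbounded.
  apply: circle_mean_cauchy => //; first exact: f_sd.
  by apply: lt_trans mc _; rewrite ltr_pdivrMr // ltr_pMr // ltr1n.
apply: culim_cvg; first exact: circle_mean_cbounded.
pose h z := f z * ((z - c') * (z - mu)^-1).
have hsd a : nc (a - c') <= rho -> strictly_diff h a.
  move=> ac'; apply: strictly_diffM; first exact: f_sd ac'.
  apply: strictly_diffM; first exact: strictly_diff_sub.
  apply: strictly_diff_inv; apply: contraTneq ac' => ->; rewrite -ltNge.
  have := cs_sep cc' cc ne; have := nc_distD mu c' c.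
  by rewrite (ncC c' mu); have := rho0; lra.
have c0 : nc (c' - c') < rho by rewrite subrr nc0.
move=> e /(circle_mean_cauchy rho0 hsd c0) [N0 hN0]; exists N0 => N /hN0.
have -> : h c' = 0 by rewrite /h subrr mul0r mulr0.
congr (nc (_ - _) <= _); congr (_ * _); apply: eq_bigr => s _; congr (_ * _).
have d0 : node c' rho N s - c' != 0 by rewrite -nc_gt0 nc_node // ltW.
have cancel (a b x : R[i]) : b != 0 -> a * (b * x) / b = a * x.
  by move=> b0; field.
exact: cancel.
Qed.

Lemma contour_add phi psi : cbounded G phi -> cbounded G psi ->
  L (fun z => phi z + psi z) = L phi + L psi.
Proof.
move=> b1 b2; rewrite /L -big_split /= big_seq [RHS]big_seq.
apply: eq_bigr => c cc; rewrite -culimD; try exact: circle_mean_cbounded.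
congr culim; apply: funext => N; rewrite /circle_mean -mulrDr -big_split.
by congr (_ * _); apply: eq_bigr => s _ /=; ring.
Qed.

Lemma contour_scale a phi : cbounded G phi ->
  L (fun z => a * phi z) = a * L phi.
Proof.
move=> b1; rewrite /L mulr_sumr big_seq [RHS]big_seq.
apply: eq_bigr => c cc; rewrite -culimZ; last exact: circle_mean_cbounded.
congr culim; apply: funext => N; rewrite /circle_mean [RHS]mulrCA.
by congr (_ * _); rewrite mulr_sumr; apply: eq_bigr => s _ /=; ring.
Qed.

Lemma contour_ext phi psi : (forall z, G z -> phi z = psi z) -> L phi = L psi.
Proof.
move=> e; rewrite /L big_seq [RHS]big_seq; apply: eq_bigr => c cc.
congr culim; apply: funext => N; congr (_ * _); apply: eq_bigr => s _.
by rewrite e //; exact: node_contour.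
Qed.

Lemma contour_bound : exists2 C : R, 0 < C & forall phi M,
    0 <= M -> (forall z, G z -> nc (phi z) <= M) -> nc (L phi) <= C * M.
Proof.
have [B' B0 hB] : exists2 B : R, 0 <= B & forall z, G z -> nc (f z) <= B.
  have [B hB] := f_bounded_contour; exists `|B| => // z Gz.
  exact: le_trans (hB _ Gz) (ler_norm _).
exists ((size cs)%:R * (rho * B') + 1).
  have rB : 0 <= rho * B' by rewrite mulr_ge0 // ltW.
  by rewrite ltr_wpDl // mulr_ge0.
move=> phi M M0 hM; rewrite mulrDl mul1r.
apply: (@le_trans _ _ ((size cs)%:R * (rho * B') * M)); last by rewrite lerDl.
have -> : (size cs)%:R * (rho * B') * M = \sum_(c <- cs) (rho * B' * M).
  by rewrite big_const_seq count_predT iter_addr_0 -mulrA mulr_natl.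
apply: le_trans (nc_sum _ _ _) _; rewrite big_seq [leRHS]big_seq.
apply: ler_sum => c cc; apply: culim_le => N; rewrite -mulrA.
apply: circle_mean_le => s; have Gs := node_contour N s cc.
by rewrite ncM ler_pM ?nc_ge0 ?hM ?hB.
Qed.

Lemma contour_open mu : U mu ->
  exists2 r : R, 0 < r & forall h, nc h < r -> U (h + mu).
Proof.
move=> [c cc mc]; exists (rho / 2 - nc (mu - c)); first by rewrite subr_gt0.
move=> h hr; exists c => //; rewrite -addrA; apply: le_lt_trans (ncD _ _) _.
by rewrite -ltrBrDr.
Qed.

Lemma contour_bounded_functional : bounded_functional G L.
Proof.
by split; [exact: contour_ext | exact: contour_add | exact: contour_scale
  | exact: contour_bound].
Qed.

(** The Cauchy formula is differentiated in [mu]. By induction [derive1n p f] is, on the open set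
    [U], [p!] times a value of [L] on a kernel depending on [mu]; the difference quotients of the
    kernel converge uniformly on [G], which gives both the existence and the value of the next
    derivative. *)
Lemma contour_pole mu p : U mu ->
  L (fun z => (z - mu)^-1 ^+ p.+1) = derive1n p f mu / p`!%:R.
Proof.
have r2 : 0 < rho / 2 by rewrite divr_gt0.
have bq nu : U nu -> cbounded G (fun z => (z - nu)^-1).
  move=> Unu; exists (rho / 2)^-1 => z Gz; have h := contour_sep Gz Unu.
  by rewrite ncV lef_pV2 ?posrE // ?(lt_le_trans _ h).
elim: p mu => [|p IHp] mu Umu.
  by rewrite fact0 divr1 -[RHS]contour_cauchy //; apply: contour_ext => z _; rewrite expr1.
set l := L _; suff -> : derive1n p.+1 f mu = p.+1`!%:R * l.
  by rewrite mulrC mulrA mulVf ?mul1r // pnatr_eq0 -lt0n fact_gt0.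
apply: (@proj2 (derivable (derive1n p f : R[i]^o -> R[i]^o) mu 1)).
apply/cderivableP.
pose x h z : R[i] := (z - (h + mu))^-1; pose y z : R[i] := (z - mu)^-1.
have [r r0 hr] := contour_open Umu.
have nU : \forall h \near (0 : R[i]^o)^', U (h + mu).
  by apply/near_dnbhs0c; exists r => // h _ /hr.
have hh : \forall h \near (0 : R[i]^o)^', h != 0.
  by apply/near_dnbhs0c; exists 1.
have PF : ProperFilter (0 : R[i]^o)^' by exact: Proper_dnbhs_numFieldType.
have ux : ucvg (0 : R[i]^o)^' G x y.
  split; first exact: bq.
  move=> e e0; have e1 : 0 < e * (rho / 2) ^+ 2 by rewrite mulr_gt0 ?exprn_gt0.
  have nh : \forall h \near (0 : R[i]^o)^', nc h < e * (rho / 2) ^+ 2.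
    by apply/near_dnbhs0c; exists (e * (rho / 2) ^+ 2).
  apply: filterS2 nU nh => h Uh he z Gz.
  have h1 := contour_sep Gz Uh; have h2 := contour_sep Gz Umu.
  have x0 : z - (h + mu) != 0 by rewrite -nc_gt0 (lt_le_trans _ h1).
  have y0 : z - mu != 0 by rewrite -nc_gt0 (lt_le_trans _ h2).
  have -> : x h z - y z = h * (z - (h + mu))^-1 * (z - mu)^-1.
    by rewrite /x /y; field; rewrite x0 y0.
  rewrite !ncM !ncV -mulrA -invfM ler_pdivrMr ?mulr_gt0 ?nc_gt0 //.
  apply: le_trans (ltW he) _; rewrite ler_pM2l // expr2.
  by apply: ler_pM; rewrite // ltW.
(* [S] is the difference quotient of the kernel: [x ^+ p.+1 - y ^+ p.+1 = h * S], by factoring the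
   difference of powers and using [x - y = h * (x * y)]. *)
pose S h z := \sum_(i < p.+1) (x h z ^+ (p - i).+1 * y z ^+ i.+1).
have uS : ucvg (0 : R[i]^o)^' G S (fun z => \sum_(i < p.+1) (y z ^+ (p - i).+1 * y z ^+ i.+1)).
  apply: ucvg_sum => i; apply: ucvgM; first exact: ucvgX.
  by apply: ucvg_cst; apply: cboundedX; exact: bq.
have {uS} uS : ucvg (0 : R[i]^o)^' G (fun h z => p`!%:R * S h z)
    (fun z => p`!%:R * (p.+1%:R * y z ^+ p.+2)).
  apply: ucvgM; first by apply: ucvg_cst; exact: cbounded_cst.
  apply: eq_ucvg uS; first by apply: filterE.
  move=> z _; rewrite (eq_bigr (fun=> y z ^+ p.+2)) => [|i _].
    by rewrite sumr_const card_ord mulr_natl.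
  by rewrite -exprD; congr (_ ^+ _); have := ltn_ord i; lia.
have bl : cbounded G (fun z => y z ^+ p.+2) by apply: cboundedX; exact: bq.
move=> e e0; have := bf_cvg (FF := PF) contour_bounded_functional uS e0.
apply: filterS3 nU hh => h Uh h0; congr (nc (_ - _) <= _); last first.
  rewrite contour_scale; last exact: cboundedM (cbounded_cst G _) bl.
  by rewrite contour_scale // mulrA -natrM mulnC.
have fE nu : U nu -> derive1n p f nu = p`!%:R * L (fun z => (z - nu)^-1 ^+ p.+1).
  by move=> /IHp ->; rewrite mulrC divfK // pnatr_eq0 -lt0n fact_gt0.
rewrite !fE // -mulrBr mulrCA.
have bx : cbounded G (fun z => x h z ^+ p.+1) by apply: cboundedX; exact: bq.
have by' : cbounded G (fun z => y z ^+ p.+1) by apply: cboundedX; exact: bq.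
rewrite -(bf_sub contour_bounded_functional) // -contour_scale; last first.
  apply: cboundedD => //.
  apply: eq_cbounded (cboundedM (cbounded_cst G (-1)) by') => z _.
  by rewrite mulN1r.
rewrite -contour_scale; last first.
  apply: cboundedM (cbounded_cst G _) _; apply: cboundedD => //.
  apply: eq_cbounded (cboundedM (cbounded_cst G (-1)) by') => z _.
  by rewrite mulN1r.
apply: contour_ext => z Gz; congr (_ * _).
have h1 := contour_sep Gz Uh; have h2 := contour_sep Gz Umu.
have x0 : z - (h + mu) != 0 by rewrite -nc_gt0 (lt_le_trans _ h1).
have y0 : z - mu != 0 by rewrite -nc_gt0 (lt_le_trans _ h2).
rewrite -/(x h z) -/(y z) subrXX /S.
have -> : x h z - y z = h * (x h z * y z) by rewrite /x /y; field; rewrite x0 y0.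
rewrite -mulrA mulKf // mulr_sumr; apply: eq_bigr => i _.
by rewrite /= !exprS; ring.
Qed.

End Construction.

(** Hides the circles: what follows sees only a functional that is exact on poles within [r] of
    [cs], and a contour at distance at least [r] from these poles. *)
Lemma exists_contour (f : R[i]^o -> R[i]^o) (Omega : set R[i]^o) (cs : seq R[i]) :
  open Omega -> (forall z, Omega z -> derivable f z 1) ->
  (forall z, Omega z -> {for z, continuous (derive1 f)}) ->
  (forall c, c \in cs -> Omega c) ->
  exists (G : set R[i]) (L : (R[i] -> R[i]) -> R[i]) (r : R),
  [/\ bounded_functional G L, 0 < r,
     forall z mu c, G z -> c \in cs -> nc (mu - c) < r -> r <= nc (z - mu) &
     forall mu c p, c \in cs -> nc (mu - c) < r ->
       L (fun z => (z - mu)^-1 ^+ p.+1) = derive1n p f mu / p`!%:R].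
Proof.
move=> Oo df cf csO.
have [r1 r10 h1] : exists2 r, 0 < r & forall c, c \in undup cs ->
    forall a, nc (a - c) <= r -> strictly_diff f a.
  apply: uniform_radius => [c r r' h r'0 rr' a ac|c].
    by apply: h; apply: le_trans rr'.
  rewrite mem_undup => /csO Oc.
  have /nbhscP [dl dl0 hdl] : nbhs (c : R[i]^o) Omega by exact: open_nbhs_nbhs.
  exists (dl / 2) => [|a ac]; first by rewrite divr_gt0.
  apply: strictly_diff_of_C1 Oo df cf _ _; apply: hdl.
  by apply: le_lt_trans ac _; rewrite ltr_pdivrMr // ltr_pMr // ltr1n.
have [r2 r20 h2] : exists2 r, 0 < r & forall c, c \in undup cs ->
    forall c', c' \in undup cs -> c != c' -> 4 * r <= nc (c - c').
  apply: uniform_radius => [c r r' h r'0 rr' c' c's ne|c _].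
    by apply: le_trans (h c' c's ne); rewrite ler_pM2l.
  apply: uniform_radius => [c' r r' h r'0 rr' ne|c' _].
    by apply: le_trans (h ne); rewrite ler_pM2l.
  have [->|ne] := eqVneq c c'; first by exists 1.
  have n0 : 0 < nc (c - c') by rewrite nc_gt0 subr_eq0.
  exists (nc (c - c') / 4) => [|_]; first by rewrite divr_gt0.
  by rewrite mulrC divfK // pnatr_eq0.
set rho := Num.min r1 r2; have rho0 : 0 < rho by rewrite lt_min r10.
have f_sd c : c \in undup cs -> forall a, nc (a - c) <= rho -> strictly_diff f a.
  by move=> cc a; rewrite le_min => /andP[/(h1 c cc)].
have sep c c' : c \in undup cs -> c' \in undup cs -> c != c' ->
    4 * rho <= nc (c - c').
  move=> cc cc' ne; apply: le_trans (h2 c cc c' cc' ne).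
  by rewrite ler_pM2l // ge_min lexx orbT.
exists [set z | exists2 c, c \in undup cs & nc (z - c) = rho].
exists (fun phi => \sum_(c <- undup cs)
   culim (fun N => circle_mean c rho N (fun z => f z * phi z))), (rho / 2).
split; first exact: contour_bounded_functional.
- by rewrite divr_gt0.
- move=> z mu c Gz cc mc; apply: contour_sep sep _ _ Gz _ => //.
  by exists c => //; rewrite mem_undup.
move=> mu c p cc mc; apply: contour_pole => //; first exact: undup_uniq.
by exists c => //; rewrite mem_undup.
Qed.
End ContourFunctional.

(** * Matrix functions as contour functionals of the resolvent *)

Section MatrixFunctional.
Variables (R : realType) (G : set R[i]) (L : (R[i] -> R[i]) -> R[i]).
Hypothesis bfL : bounded_functional G L.

Definition mxfunctional m n (Phi : R[i] -> 'M[R[i]]_(m, n)) : 'M[R[i]]_(m, n) :=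
  \matrix_(i, j) L (fun z => Phi z i j).

Definition mx_cbounded m n (Phi : R[i] -> 'M[R[i]]_(m, n)) :=
  forall i j, cbounded G (fun z => Phi z i j).

Lemma eq_mxfunctional m n (Phi Psi : R[i] -> 'M[R[i]]_(m, n)) :
  (forall z, G z -> Phi z = Psi z) -> mxfunctional Phi = mxfunctional Psi.
Proof.
by move=> e; apply/matrixP => i j; rewrite !mxE; apply: (bf_ext bfL) => z /e ->.
Qed.

Lemma mx_cbounded_mul m n p (Phi : R[i] -> 'M[R[i]]_(m, n))
    (Psi : R[i] -> 'M[R[i]]_(n, p)) :
  mx_cbounded Phi -> mx_cbounded Psi -> mx_cbounded (fun z => Phi z *m Psi z).
Proof.
move=> b1 b2 i j; under eq_fun do rewrite mxE.
by apply: cbounded_sum => k _; apply: cboundedM.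
Qed.

Lemma mx_cbounded_cst m n (P : 'M[R[i]]_(m, n)) : mx_cbounded (fun=> P).
Proof. by move=> i j; exact: cbounded_cst. Qed.

Lemma mxfunctional_mull m n p (P : 'M[R[i]]_(m, n))
    (Phi : R[i] -> 'M[R[i]]_(n, p)) : mx_cbounded Phi ->
  mxfunctional (fun z => P *m Phi z) = P *m mxfunctional Phi.
Proof.
move=> b; apply/matrixP => i j; rewrite !mxE.
under eq_fun do rewrite mxE.
rewrite (bf_sum bfL) => [|k]; last exact: cboundedM (cbounded_cst _ _) (b _ _).
by apply: eq_bigr => k _; rewrite (bf_scale bfL) ?mxE //; exact: b.
Qed.

Lemma mxfunctional_mulr m n p (P : 'M[R[i]]_(n, p))
    (Phi : R[i] -> 'M[R[i]]_(m, n)) : mx_cbounded Phi ->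
  mxfunctional (fun z => Phi z *m P) = mxfunctional Phi *m P.
Proof.
move=> b; apply/matrixP => i j; rewrite !mxE.
under eq_fun do rewrite mxE.
rewrite (bf_sum bfL) => [|k]; last exact: cboundedM (b _ _) (cbounded_cst _ _).
apply: eq_bigr => k _; rewrite mulrC mxE -(bf_scale bfL) //.
by apply: (bf_ext bfL) => z _; rewrite mulrC.
Qed.

Lemma mxfunctional_sum m n I (s : seq I) (Phi : I -> R[i] -> 'M[R[i]]_(m, n)) :
  (forall i, mx_cbounded (Phi i)) ->
  mxfunctional (fun z => \sum_(i <- s) Phi i z) =
  \sum_(i <- s) mxfunctional (Phi i).
Proof.
move=> b; apply/matrixP => i j; rewrite mxE summxE.
rewrite (bf_ext bfL (psi := fun z => \sum_(k <- s) Phi k z i j)) => [|z _].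
  by rewrite (bf_sum bfL) => [|k]; [apply: eq_bigr => k _; rewrite mxE | exact: b].
by rewrite summxE.
Qed.

End MatrixFunctional.

Section JordanResolvent.
Variable R : realType.
Implicit Types z mu : R[i].

(** The inverse of [z] minus a Jordan block, by the geometric series in the nilpotent part. The
    functional sends its entries to those of [fun_jordan_block]. *)
Definition jordan_resolvent p mu z : 'M[R[i]]_p :=
  \matrix_(a, b) (if (a <= b)%N then (z - mu)^-1 ^+ (b - a).+1 else 0).

Lemma mulmx_jordan_resolvent p mu z : z != mu ->
  (z%:M - jordan_block p mu) *m jordan_resolvent p mu z = 1%:M.
Proof.
move=> zmu; have d0 : z - mu != 0 by rewrite subr_eq0.
apply/matrixP => a b; rewrite !mxE (bigD1 a) //= !mxE !eqxx mulr1n.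
have [ab|ba] := ltnP a b.
  have ap : (a.+1 < p)%N by apply: leq_ltn_trans (ltn_ord b).
  rewrite (bigD1 (Ordinal ap)) /=; last by rewrite -val_eqE /= gtn_eqF.
  rewrite big1 ?addr0 => [|c /andP[ca cap]].
    rewrite !mxE -!val_eqE /= eqxx ab (ltnW ab) [a == a.+1 :> nat]ltn_eqF //.
    rewrite ltn_eqF // subnS prednK ?subn_gt0 // mulr0n sub0r mulN1r exprS mulrA.
    by rewrite mulfV // mul1r subrr.
  rewrite !mxE [a == c]eq_sym (negbTE ca) mulr0n sub0r.
  by move: cap; rewrite -val_eqE /= => /negbTE ->; rewrite oppr0 mul0r.
rewrite big1 ?addr0 => [|c ca].
  have [E|ne] := eqVneq a b; first by rewrite E leqnn subnn expr1 mulfV.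
  by rewrite leqNgt ltn_neqAle eq_sym ne ba /= mulr0.
rewrite !mxE [a == c]eq_sym (negbTE ca) mulr0n sub0r.
case: eqP => [->|]; last by rewrite oppr0 mul0r.
by rewrite leqNgt ltnS ba /= mulr0.
Qed.

(** [eigenvalue] is about row vectors: the last unit row of block [b] is a left eigenvector of the
    block diagonal matrix, carried over to [A] by [jf_inv]. *)
Lemma jordan_form_eigenvalue n (A : 'M[R[i]]_n) (J : jordan_form A) b :
  eigenvalue A (@jf_eig _ _ _ J b).
Proof.
case: J b => N p_ mu P P' p0 PP' P'P AE b /=; rewrite AE; set D := mxdiag _.
pose e i : 'rV[R[i]]_(p_ i) := \row_a ((i == b) && (a.+1 == p_ i))%:R.
pose v := \mxrow_i e i.
have ev i : e i *m jordan_block (p_ i) (mu i) = mu b *: e i.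
  apply/rowP; have [->|ib] := eqVneq i b => a; rewrite !mxE; last first.
    by rewrite (negbTE ib) mulr0 big1 // => c _; rewrite mxE (negbTE ib) mul0r.
  rewrite (bigD1 a) //= !mxE !eqxx /= mulrC big1 ?addr0 // => c ca.
  rewrite !mxE (negbTE ca) /=; case: (c.+1 =P p_ b) => [cp|_].
    by rewrite cp ltn_eqF ?mulr0.
  by rewrite andbF mul0r.
have vD : v *m D = mu b *: v.
  rewrite /v /D mul_mxrow_mxdiag; apply/rowP => j.
  by rewrite [LHS]mxE ev !mxE.
have v0 : v != 0.
  apply/eqP => v0; have pb : ((p_ b).-1 < p_ b)%N by rewrite ltn_predL p0.
  have := mxrowK e b; rewrite -/v v0 => /rowP/(_ (Ordinal pb)).
  rewrite !mxE eqxx /= prednK ?p0 // eqxx => /eqP.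
  by rewrite eq_sym oner_eq0.
apply/eigenvalueP; exists (v *m P').
  by rewrite !mulmxA -(mulmxA v) P'P mulmx1 vD scalemxAl.
by apply: contra v0 => /eqP/(congr1 (mulmx^~ P)); rewrite -mulmxA P'P mulmx1 mul0mx => ->.
Qed.

Definition conj_jordan_resolvent n (A : 'M[R[i]]_n) (J : jordan_form A) z :=
  jf_base J *m (\mxdiag_b jordan_resolvent (@jf_size _ _ _ J b) (@jf_eig _ _ _ J b) z)
    *m jf_inv J.

Lemma invmx_jordan n (A : 'M[R[i]]_n) (J : jordan_form A) z :
  (forall b, z != @jf_eig _ _ _ J b) ->
  invmx (z%:M - A) = conj_jordan_resolvent J z.
Proof.
move=> zJ; suff h : (z%:M - A) *m conj_jordan_resolvent J z = 1%:M.
  have [u _] := mulmx1_unit h.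
  by rewrite -[RHS](mulKmx u) h mulmx1.
rewrite /conj_jordan_resolvent.
case: J zJ => N p_ mu P P' p0 PP' P'P AE zJ /=; rewrite AE; set D := mxdiag _.
have -> : z%:M - P *m D *m P' = P *m (z%:M - D) *m P'.
  rewrite mulmxBr mulmxBl; congr (_ - _).
  by rewrite mul_mx_scalar -scalemxAl PP' scalemx1.
rewrite -!mulmxA (mulmxA P' P) P'P mul1mx (mulmxA (z%:M - D)).
suff -> : (z%:M - D) *m (\mxdiag_b jordan_resolvent (p_ b) (mu b) z) = 1%:M.
  by rewrite mul1mx.
rewrite -[z%:M](@mxdiagZ _ _ p_) -mxdiagB [X in _ *m X]/mxdiag mul_mxdiag_mxblock.
rewrite -[1%:M](@mxdiagZ _ _ p_) /mxdiag; apply: eq_mxblock => i j.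
case: eqVneq => [E|_]; last by rewrite mulmx0.
by case: _ / E => /=; rewrite !conform_mx_id mulmx_jordan_resolvent.
Qed.

End JordanResolvent.

Section FunJordan.
Variables (R : realType) (G : set R[i]) (L : (R[i] -> R[i]) -> R[i]).
Variable f : R[i]^o -> R[i]^o.
Hypothesis bfL : bounded_functional G L.

(** The right-hand side does not involve [J], so this also shows that the value is the same for all
    Jordan forms, as [matrix_fun] requires. *)
Lemma fun_jordan_functional n (A : 'M[R[i]]_n) (J : jordan_form A) :
  (forall mu, eigenvalue A mu ->
    (exists2 k : R, 0 < k & forall z, G z -> k <= nc (z - mu)) /\
    forall p, L (fun z => (z - mu)^-1 ^+ p.+1) = derive1n p f mu / p`!%:R) ->
  fun_jordan f J = mxfunctional L (fun z => invmx (z%:M - A)).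
Proof.
move=> hA; pose far b := (hA _ (@jordan_form_eigenvalue _ _ _ J b)).1.
pose pole b := (hA _ (@jordan_form_eigenvalue _ _ _ J b)).2.
rewrite (eq_mxfunctional bfL (Psi := conj_jordan_resolvent J)); last first.
  move=> z Gz; apply: invmx_jordan => b; have [k k0 /(_ z Gz)] := far b.
  by apply: contraTneq => ->; rewrite subrr nc0 -ltNge.
rewrite /conj_jordan_resolvent /fun_jordan.
pose D z := \mxdiag_b jordan_resolvent (@jf_size _ _ _ J b) (@jf_eig _ _ _ J b) z.
have bD : mx_cbounded G D.
  move=> i j; rewrite /D /mxdiag /mxblock.
  under eq_fun do rewrite mxE.
  move: (tagnat.sig2 i) (tagnat.sig2 j).
  case: eqVneq => [E|_] a c; last first.
    by under eq_fun do rewrite mxE; exact: cbounded_cst.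
  case: _ / E c => c; rewrite /= .
  under eq_fun do rewrite conform_mx_id mxE.
  case: (a <= c)%N; last exact: cbounded_cst.
  have [k k0 hk] := far (tagnat.sig1 i).
  apply: cboundedX; exists k^-1 => z Gz; have h := hk z Gz.
  by rewrite ncV lef_pV2 ?posrE // (lt_le_trans _ h).
rewrite (mxfunctional_mulr bfL); last first.
  exact: mx_cbounded_mul (mx_cbounded_cst _ _) bD.
rewrite (mxfunctional_mull bfL); last exact: bD.
congr (_ *m _ *m _).
apply/matrixP => i j; rewrite [RHS]mxE [LHS]mxE /mxdiag /mxblock.
under [X in _ = L X]eq_fun do rewrite mxE.
move: (tagnat.sig2 i) (tagnat.sig2 j).
case: eqVneq => [E|_] a c; last first.
  by under [X in _ = L X]eq_fun do rewrite mxE; rewrite mxE (bf0 bfL).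
case: _ / E c => c /=; under [X in _ = L X]eq_fun do rewrite conform_mx_id mxE.
rewrite conform_mx_id mxE; case: (a <= c)%N; last by rewrite (bf0 bfL).
by rewrite pole.
Qed.

Lemma matrix_fun_functional n (A : 'M[R[i]]_n) (J : jordan_form A) :
  (forall mu, eigenvalue A mu ->
    (exists2 k : R, 0 < k & forall z, G z -> k <= nc (z - mu)) /\
    forall p, L (fun z => (z - mu)^-1 ^+ p.+1) = derive1n p f mu / p`!%:R) ->
  matrix_fun f A = mxfunctional L (fun z => invmx (z%:M - A)).
Proof.
move=> hA; apply: xget_unique; first by exists J; rewrite fun_jordan_functional.
by move=> _ [J' ->]; rewrite fun_jordan_functional.
Qed.

End FunJordan.

(** * Spectrum and resolvent near a unitarily diagonalizable matrix *)

Section Perturbation.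
Variables (R : realType) (n : nat) (lam : 'rV[R[i]]_n) (E : 'M[R[i]]_n).
Variables (r e : R).
Hypotheses (r0 : 0 < r) (ner : n%:R * e <= r / 2).
Hypothesis Ee : forall i j, nc (E i j) <= e.

Lemma max_entry (v : 'rV[R[i]]_n) : v != 0 ->
  exists2 j, 0 < nc (v 0 j) & forall i, nc (v 0 i) <= nc (v 0 j).
Proof.
move=> v0; have [j0 vj0] : exists j, v 0 j != 0.
  apply/existsP; rewrite -negb_forall; apply: contra v0 => /forallP h.
  by apply/eqP/rowP => i; rewrite mxE; apply/eqP.
case: (@Order.TotalTheory.arg_maxP _ R _ j0 xpredT (fun j => nc (v 0 j))) => // j _ hj.
exists j => [|i]; last exact: hj.
by apply: lt_le_trans (hj j0 isT); rewrite nc_gt0.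
Qed.

(** A Gershgorin argument at the entry of [v] of largest modulus: [z - lam] contributes a factor at
    least [r] and [E] takes back at most [r / 2]. Taking [W = 0] gives invertibility and the
    location of eigenvalues, [W = 1] the bound on the inverse. *)
Lemma perturbed_lower_bound z (v : 'rV[R[i]]_n) (W : R) :
  (forall i, r <= nc (z - lam 0 i)) ->
  (forall i, nc ((v *m (z%:M - (diag_mx lam + E))) 0 i) <= W) -> 0 <= W ->
  forall i, nc (v 0 i) <= 2 * W / r.
Proof.
move=> hz hW W0 i; have [->|v0] := eqVneq v 0.
  by rewrite mxE nc0 divr_ge0 ?mulr_ge0 // ltW.
have [j vj0 hj] := max_entry v0; apply: le_trans (hj i) _.
set w := v *m _ in hW; set V := nc (v 0 j) in vj0 hj *.
have key : v 0 j * (z - lam 0 j) = w 0 j + (v *m E) 0 j.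
  rewrite /w opprD addrA mulmxBr mulmxBr mul_mx_scalar mul_mx_diag.
  by move: (v *m E) => w1; rewrite !mxE subrK mulrBr [z * _]mulrC.
have vE : nc ((v *m E) 0 j) <= V * (r / 2).
  rewrite mxE; apply: le_trans (nc_sum _ _ _) _.
  apply: (@le_trans _ _ (\sum_(k < n) V * e)).
    by apply: ler_sum => k _; rewrite ncM ler_pM ?nc_ge0.
  rewrite sumr_const card_ord -mulrnAr ler_pM2l //.
  by apply: le_trans ner; rewrite mulr_natl.
have : V * r <= W + V * (r / 2).
  apply: le_trans (_ : V * r <= V * nc (z - lam 0 j)) _; first by rewrite ler_pM2l.
  rewrite -ncM key; apply: le_trans (ncD _ _) _; exact: lerD.
rewrite ler_pdivlMr // => h; lra.
Qed.

Lemma perturbed_eigenvalue mu : eigenvalue (diag_mx lam + E) mu ->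
  exists i, nc (mu - lam 0 i) < r.
Proof.
move=> /eigenvalueP [v vE v0]; apply: contrapT => hn.
have hz i : r <= nc (mu - lam 0 i).
  by rewrite leNgt; apply/negP => h; apply: hn; exists i.
have [j vj _] := max_entry v0.
have := @perturbed_lower_bound mu v 0 hz _ (lexx _) j.
rewrite mulr0 mul0r leNgt vj => h.
suff: false by []. apply: h => i.
by rewrite mulmxBr vE mul_mx_scalar subrr mxE nc0.
Qed.

Lemma perturbed_unit z : (forall i, r <= nc (z - lam 0 i)) ->
  z%:M - (diag_mx lam + E) \in unitmx.
Proof.
move=> hz; rewrite -row_free_unit -kermx_eq0; apply/rowV0P => v /sub_kermxP vM.
apply/rowP => i; rewrite mxE; apply/eqP; rewrite -nc_eq0 eq_le nc_ge0 andbT.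
have := @perturbed_lower_bound z v 0 hz _ (lexx _) i; rewrite mulr0 mul0r; apply.
by move=> j; rewrite vM mxE nc0.
Qed.

Lemma perturbed_inverse_bound z : (forall i, r <= nc (z - lam 0 i)) ->
  forall i j, nc (invmx (z%:M - (diag_mx lam + E)) i j) <= 2 / r.
Proof.
move=> hz i j; set M := z%:M - _.
have := @perturbed_lower_bound z (row i (invmx M)) 1 hz _ ler01 j.
rewrite mxE mulr1; apply => k.
rewrite -row_mul mulVmx ?perturbed_unit // row1 mxE eqxx /=.
by case: (_ == _); rewrite ?nc1 ?nc0.
Qed.

End Perturbation.

Section UnitaryPerturbation.
Variables (R : realType) (n : nat) (lam : 'rV[R[i]]_n) (A0 Q : 'M[R[i]]_n).
Hypothesis Q_unitary : Q \is unitarymx.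
Hypothesis A0_diag : Q^t* *m A0 *m Q = diag_mx lam.

Lemma unitary_mulVmx : Q^t* *m Q = 1%:M.
Proof. by apply: mulmx1C; exact/unitarymxP. Qed.

Lemma conj_resolvent B z :
  z%:M - B = Q *m (z%:M - (diag_mx lam + Q^t* *m (B - A0) *m Q)) *m Q^t*.
Proof.
have QQ : Q *m Q^t* = 1%:M by exact/unitarymxP.
rewrite -A0_diag -mulmxDl -mulmxDr [A0 + _]addrC subrK mulmxBr mulmxBl.
congr (_ - _); first by rewrite mul_mx_scalar -scalemxAl QQ scalemx1.
by rewrite !mulmxA QQ mul1mx -mulmxA QQ mulmx1.
Qed.

Lemma unitary_perturbation r : 0 < r -> exists (e C : R), [/\ 0 < e,
  forall B : 'M[R[i]]_n, (forall i j, nc (B i j - A0 i j) <= e) ->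
     (forall z, (forall i, r <= nc (z - lam 0 i)) ->
        z%:M - B \in unitmx /\ forall i j, nc (invmx (z%:M - B) i j) <= C) &
  forall B : 'M[R[i]]_n, (forall i j, nc (B i j - A0 i j) <= e) ->
     forall mu, eigenvalue B mu -> exists i, nc (mu - lam 0 i) < r].
Proof.
move=> r0; have QQ : Q *m Q^t* = 1%:M by exact/unitarymxP.
have VQ := unitary_mulVmx.
have bd (P1 P2 : 'M[R[i]]_n) : exists2 C : R, 0 < C &
    forall (X : 'M[R[i]]_n) (e : R), 0 <= e -> (forall i j, nc (X i j) <= e) ->
    forall i j, nc ((P1 *m X *m P2) i j) <= C * e.
  pose C := \sum_i \sum_j \sum_k \sum_l nc (P1 i k) * nc (P2 l j).
  have C0 : 0 <= C by do 4![apply: sumr_ge0 => ? _]; rewrite mulr_ge0 ?nc_ge0.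
  exists (C + 1); first by rewrite ltr_wpDl.
  move=> X e e0 hX i j; rewrite mxE; apply: le_trans (nc_sum _ _ _) _.
  apply: (@le_trans _ _ (C * e)); last by rewrite ler_wpM2r // lerDl.
  apply: (@le_trans _ _ ((\sum_k \sum_l nc (P1 i k) * nc (P2 l j)) * e)).
    rewrite exchange_big mulr_suml; apply: ler_sum => l _.
    rewrite mxE ncM mulr_suml; apply: le_trans (ler_wpM2r _ (nc_sum _ _ _)) _.
      exact: nc_ge0.
    rewrite mulr_suml; apply: ler_sum => k _; rewrite ncM mulrAC.
    by rewrite ler_wpM2l // mulr_ge0 ?nc_ge0.
  rewrite ler_wpM2r // /C [leRHS](bigD1 i) //= [X in _ <= X + _](bigD1 j) //=.
  rewrite -addrA lerDl.
  by rewrite addr_ge0 //; do ![apply: sumr_ge0 => ? _]; rewrite mulr_ge0 ?nc_ge0.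
have [C1 C10 h1] := bd (Q^t*) Q; have [C2 C20 h2] := bd Q (Q^t*).
(* Conjugation by [Q] turns [e] into [C1 * e], and [n * (C1 * e)] must not exceed [r / 2]; [n + 1]
   is positive even for [n = 0]. *)
pose e : R := r / 2 / (n%:R + 1) / C1.
have n10 : 0 < n%:R + 1 :> R by rewrite ltr_wpDl.
have e0 : 0 < e by rewrite !divr_gt0.
have ner : n%:R * (C1 * e) <= r / 2.
  have -> : n%:R * (C1 * e) = r / 2 * (n%:R / (n%:R + 1)).
    by rewrite /e; move: (n%:R + 1) n10 => n1 n10; field; rewrite !gt_eqF.
  by rewrite ler_piMr ?divr_ge0 ?(ltW r0) // ler_pdivrMr // mul1r lerDl.
have hE (B : 'M[R[i]]_n) : (forall i j, nc (B i j - A0 i j) <= e) ->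
    forall i j, nc ((Q^t* *m (B - A0) *m Q) i j) <= C1 * e.
  by move=> hB; apply: h1 (ltW e0) _ => i j; rewrite mxE [X in _ + X]mxE.
exists e, (C2 * (2 / r)); split => // B /hE hB.
  move=> z hz; have u := perturbed_unit r0 ner hB hz.
  set M := _ - _ in u; have iM : (z%:M - B) *m (Q *m invmx M *m Q^t*) = 1%:M.
    rewrite conj_resolvent -/M -!mulmxA (mulmxA (Q^t*) Q) VQ mul1mx.
    by rewrite (mulmxA M) mulmxV // mul1mx.
  have [uB _] := mulmx1_unit iM; split=> // i j.
  rewrite -[invmx _](mulmx1 _) -iM mulKmx //.
  apply: h2; first by rewrite divr_ge0 // ltW.
  by move=> k l; have := perturbed_inverse_bound r0 ner hB hz k l.
move=> mu /eigenvalueP [v vB v0]; apply: (perturbed_eigenvalue r0 ner hB).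
apply/eigenvalueP; exists (v *m Q).
  have : v *m (mu%:M - B) = 0 by rewrite mulmxBr mul_mx_scalar vB subrr.
  rewrite conj_resolvent; set M := _ + _ => /(congr1 (fun X => X *m Q)).
  rewrite mul0mx -!mulmxA VQ mulmx1 mulmxA mulmxBr mul_mx_scalar.
  by move/eqP; rewrite subr_eq0 eq_sym => /eqP; rewrite -!mulmxA.
apply: contra v0 => /eqP/(congr1 (mulmx^~ (Q^t*))).
by rewrite -mulmxA QQ mulmx1 mul0mx => ->.
Qed.

End UnitaryPerturbation.

(** * Derivatives of products of resolvents *)

Section EntrywiseDerivative.
Variables (R : realType) (r n : nat).
Implicit Types (F : 'rV[R]_r -> 'M[R[i]]_n) (y v : 'rV[R]_r) (M : 'M[R[i]]_n).

Definition diff_quotient F y v (h : R) : 'M[R[i]]_n :=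
  (h^-1)%:C *: (F (h *: v + y) - F y).

Definition has_mx_deriv F y v M := forall i j (e : R), 0 < e ->
  \forall h \near (0 : R)^', nc (diff_quotient F y v h i j - M i j) <= e.

Lemma cvg_mxP (T : Type) (U : set_system T) (FU : Filter U)
    (S : T -> 'M[R]_n) (D : 'M[R]_n) :
  S @ U --> D <-> forall i j, S x i j @[x --> U] --> D i j.
Proof.
split=> [h i j|h].
  exact: (cvg_comp _ _ h (@coord_continuous _ _ _ i j D)).
apply/cvgrPdist_le => e e0.
have hh (ij : 'I_n * 'I_n) : \forall x \near U, `|D ij.1 ij.2 - S x ij.1 ij.2| <= e.
  by move: e e0; apply/cvgrPdist_le; exact: h.
near=> x.
rewrite /Num.Def.normr/= mx_normrE (bigmax_le _ (ltW e0))//= => ij _.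
by rewrite !mxE; move: ij; near: x; apply: filter_forall.
Unshelve. all: by end_near. Qed.

Lemma Re_diff_quotient F y v h i j :
  (h^-1 *: ((Re_mx F \o shift y) (h *: v) - Re_mx F y)) i j =
  complex.Re (diff_quotient F y v h i j).
Proof. by rewrite !mxE /=; case: (F _ i j) (F y i j) => a b [c d] /=; ring. Qed.

Lemma Im_diff_quotient F y v h i j :
  (h^-1 *: ((Im_mx F \o shift y) (h *: v) - Im_mx F y)) i j =
  complex.Im (diff_quotient F y v h i j).
Proof. by rewrite !mxE /=; case: (F _ i j) (F y i j) => a b [c d] /=; ring. Qed.

Lemma has_mx_derivP F y v (DR DI : 'M[R]_n) :
  (h^-1 *: ((Re_mx F \o shift y) (h *: v) - Re_mx F y) @[h --> (0 : R)^'] --> DR /\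
   h^-1 *: ((Im_mx F \o shift y) (h *: v) - Im_mx F y) @[h --> (0 : R)^'] --> DI)
  <-> has_mx_deriv F y v (map2_mx (@Complex R) DR DI).
Proof.
rewrite !cvg_mxP; split=> [[hR hI] i j e e0|h].
  have e2 : 0 < e / 2 by rewrite divr_gt0.
  move/cvgrPdist_le: (hR i j) => /(_ _ e2) h1.
  move/cvgrPdist_le: (hI i j) => /(_ _ e2) h2.
  apply: filterS2 h1 h2 => x /=; rewrite Re_diff_quotient Im_diff_quotient.
  move=> h1 h2.
  have n1 : nc (diff_quotient F y v x i j - Complex (DR i j) (DI i j)) <=
      `|complex.Re (diff_quotient F y v x i j) - DR i j| +
      `|complex.Im (diff_quotient F y v x i j) - DI i j|.
    by apply: le_trans (nc_le_ReIm _) _; case: (diff_quotient F y v x i j).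
  by rewrite [X in _ - X]mxE; apply: le_trans n1 _; rewrite [leRHS]splitr lerD // distrC.
split=> i j; apply/cvgrPdist_le => e e0; apply: filterS (h i j e e0) => x;
  rewrite ?Re_diff_quotient ?Im_diff_quotient [X in nc (_ - X)]mxE distrC;
  move: (diff_quotient F y v x i j) => [a b]; apply: le_trans.
  exact: le_trans (normr_Re_le _).
exact: le_trans (normr_Im_le _).
Qed.

Lemma mx_derivable_deriv F y (j : 'I_r) : mx_derivable F y (delta_mx 0 j) ->
  has_mx_deriv F y (delta_mx 0 j) (partial j F y).
Proof.
move=> [dR dI]; rewrite /partial.
by apply: (has_mx_derivP F y (delta_mx 0 j) _ _).1; split; [exact: dR | exact: dI].
Qed.

Lemma has_mx_deriv_derivable F y (j : 'I_r) M :
  has_mx_deriv F y (delta_mx 0 j) M ->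
  mx_derivable F y (delta_mx 0 j) /\ partial j F y = M.
Proof.
have -> : M = map2_mx (@Complex R) (map_mx (@complex.Re R) M) (map_mx (@complex.Im R) M).
  by apply/matrixP => a b; rewrite !mxE; case: (M a b).
move=> /has_mx_derivP [hR hI]; split.
  by split; apply/cvg_ex; [exists (map_mx (@complex.Re R) M) |
     exists (map_mx (@complex.Im R) M)].
by rewrite /partial /derive (cvg_lim _ hR) // (cvg_lim _ hI).
Qed.

Lemma near_line y v (P : 'rV[R]_r -> Prop) : (\forall x \near y, P x) ->
  \forall h \near (0 : R)^', P (h *: v + y).
Proof.
move=> hP.
have c : (h *: v + y) @[h --> (0 : R)] --> (0 *: v + y : 'rV[R]_r).
  by apply: cvgD; [apply: cvgZr_tmp; exact: cvg_id | exact: cvg_cst].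
rewrite scale0r add0r in c.
by apply: cvg_within; exact: c hP.
Qed.

Lemma near_eq_has_mx_deriv F1 F2 y v M : (\forall x \near y, F1 x = F2 x) ->
  has_mx_deriv F1 y v M -> has_mx_deriv F2 y v M.
Proof.
move=> e12 h i j e e0; have e0' := nbhs_singleton e12.
apply: filterS2 (near_line v e12) (h i j e e0) => x ex.
by rewrite /diff_quotient -ex -e0'.
Qed.

End EntrywiseDerivative.

Section UniformDerivative.
Variables (R : realType) (n : nat) (G : set R[i]).
Implicit Types (S : R -> R[i] -> 'M[R[i]]_n) (D : R[i] -> 'M[R[i]]_n).

Definition mx_ucvg S D := forall i j,
  ucvg (0 : R)^' G (fun h z => S h z i j) (fun z => D z i j).

Lemma mx_ucvgD S1 D1 S2 D2 : mx_ucvg S1 D1 -> mx_ucvg S2 D2 ->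
  mx_ucvg (fun h z => S1 h z + S2 h z) (fun z => D1 z + D2 z).
Proof.
move=> h1 h2 i j; apply: eq_ucvg (ucvgD (h1 i j) (h2 i j)).
  by apply: filterE => h z _; rewrite mxE.
by move=> z _; rewrite mxE.
Qed.

Lemma mx_ucvgM S1 D1 S2 D2 : mx_ucvg S1 D1 -> mx_ucvg S2 D2 ->
  mx_ucvg (fun h z => S1 h z *m S2 h z) (fun z => D1 z *m D2 z).
Proof.
move=> h1 h2 i j.
apply: eq_ucvg (ucvg_sum (index_enum 'I_n) (fun k => ucvgM (h1 i k) (h2 k j))).
  by apply: filterE => h z _; rewrite mxE.
by move=> z _; rewrite mxE.
Qed.

Lemma mx_ucvg_cst D : mx_cbounded G D -> mx_ucvg (fun=> D) D.
Proof. by move=> b i j; exact: ucvg_cst. Qed.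

Lemma eq_mx_ucvg S1 S2 D1 D2 :
  (\forall h \near (0 : R)^', forall z, G z -> S1 h z = S2 h z) ->
  (forall z, G z -> D1 z = D2 z) -> mx_ucvg S1 D1 -> mx_ucvg S2 D2.
Proof.
move=> eS eD u i j; apply: eq_ucvg (u i j).
  by apply: filterS eS => h e z /e ->.
by move=> z /eD ->.
Qed.

(** Convergence of the values is carried along with that of the difference quotients, because the
    product rule [udiffM] uses it. *)
Definition udiff S D0 D := mx_ucvg S D0 /\
  mx_ucvg (fun h z => (h^-1)%:C *: (S h z - D0 z)) D.

Lemma udiffM S1 A1 D1 S2 A2 D2 : udiff S1 A1 D1 -> udiff S2 A2 D2 ->
  udiff (fun h z => S1 h z *m S2 h z) (fun z => A1 z *m A2 z)
    (fun z => D1 z *m A2 z + A1 z *m D2 z).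
Proof.
move=> [c1 d1] [c2 d2]; split; first exact: mx_ucvgM.
have b1 : mx_cbounded G A1 by move=> i j; case: (c1 i j).
apply: eq_mx_ucvg (mx_ucvgD (mx_ucvgM d1 c2) (mx_ucvgM (mx_ucvg_cst b1) d2)) => //.
apply: filterE => h z _; rewrite -scalemxAl -scalemxAr -scalerDr; congr (_ *: _).
by rewrite mulmxBl mulmxBr addrA subrK.
Qed.

Lemma udiff_const r (F : 'rV[R]_r -> 'M[R[i]]_n) y v M : has_mx_deriv F y v M ->
  udiff (fun h _ => F (h *: v + y)) (fun=> F y) (fun=> M).
Proof.
move=> hM; have d : mx_ucvg (fun h _ => (h^-1)%:C *: (F (h *: v + y) - F y)) (fun=> M).
  by move=> i j; apply: ucvg_indep => e e0; exact: hM.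
split=> // i j.
have u0 : ucvg (0 : R)^' G (fun h _ => h%:C) (fun=> 0).
  apply: ucvg_indep => e e0; exists e => //= h.
  by rewrite /= sub0r normrN subr0 nc_real => /ltW.
have uF : ucvg (0 : R)^' G (fun=> fun=> F y i j) (fun=> F y i j).
  by apply: ucvg_cst; exact: cbounded_cst.
apply: eq_ucvg (ucvgD (ucvgM u0 (d i j)) uF); last first.
  by move=> z _; rewrite mul0r add0r.
have nz : \forall h \near (0 : R)^', h != 0 by exact: nbhs_dnbhs_neq.
apply: filterS nz => h h0 z _; rewrite !mxE mulrA -rmorphM /= divff // rmorph1 mul1r.
by rewrite subrK.
Qed.

(** Serves before the convergence of the perturbed resolvent is known: a uniform bound on it is
    enough when the other factor tends to 0. *)
Lemma ucvg_bounded_mul (S1 S2 : R -> R[i] -> R[i]) :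
  (exists C : R, \forall h \near (0 : R)^', forall z, G z -> nc (S1 h z) <= C) ->
  ucvg (0 : R)^' G S2 (fun=> 0) ->
  ucvg (0 : R)^' G (fun h z => S1 h z * S2 h z) (fun=> 0).
Proof.
move=> [C nC] [_ h2]; split; first exact: cbounded_cst.
move=> e e0; have K0 : 0 < `|C| + 1 by rewrite ltr_wpDl.
have eK : 0 < e / (`|C| + 1) by rewrite divr_gt0.
apply: filterS2 nC (h2 _ eK) => h hC hh z Gz; rewrite subr0 ncM.
have := hh z Gz; rewrite subr0 => h3.
apply: (@le_trans _ _ ((`|C| + 1) * (e / (`|C| + 1)))).
  apply: ler_pM; rewrite ?nc_ge0 //; apply: le_trans (hC z Gz) _.
  by apply: le_trans (ler_norm _) _; rewrite lerDl.
by rewrite mulrC divfK // gt_eqF.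
Qed.

Definition resolvent r (A : 'rV[R]_r -> 'M[R[i]]_n) x (z : R[i]) :=
  invmx (z%:M - A x).

(** The resolvent identity [R' - R = R' (A' - A) R] is used twice: with [R'] merely bounded it gives
    the convergence of [R'] to [R], and after division by [h] the derivative. *)
Lemma udiff_resolvent r (A : 'rV[R]_r -> 'M[R[i]]_n) y v M (C : R) :
  (\forall x \near y, forall z, G z ->
     z%:M - A x \in unitmx /\ forall i j, nc (resolvent A x z i j) <= C) ->
  has_mx_deriv A y v M ->
  udiff (fun h => resolvent A (h *: v + y)) (resolvent A y)
    (fun z => resolvent A y z *m M *m resolvent A y z).
Proof.
move=> nA hM; have Ay := nbhs_singleton nA.
have [cA dA] := udiff_const hM; have nh := near_line v nA.
have bR : mx_cbounded G (resolvent A y).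
  by move=> i j; exists C => z /Ay [_]; apply.
have resB : \forall h \near (0 : R)^', forall z, G z ->
    resolvent A (h *: v + y) z - resolvent A y z =
    resolvent A (h *: v + y) z *m ((A (h *: v + y) - A y) *m resolvent A y z).
  apply: filterS nh => h hh z Gz; have [u1 _] := hh z Gz; have [u2 _] := Ay z Gz.
  have -> : A (h *: v + y) - A y = (z%:M - A y) - (z%:M - A (h *: v + y)).
    by rewrite opprB [RHS]addrC subrKA.
  by rewrite /resolvent mulmxBl mulmxBr mulmxV // mulmx1 mulKmx.
have cR : mx_ucvg (fun h => resolvent A (h *: v + y)) (resolvent A y).
  have cB : mx_ucvg (fun h z => (A (h *: v + y) - A y) *m resolvent A y z) (fun=> 0).
    have cN := mx_ucvg_cst (mx_cbounded_cst G (- A y)).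
    apply: eq_mx_ucvg (mx_ucvgM (mx_ucvgD cA cN) (mx_ucvg_cst bR)).
      by apply: filterE.
    by move=> z _; rewrite subrr mul0mx.
  have c0 : mx_ucvg (fun h z => resolvent A (h *: v + y) z - resolvent A y z) (fun=> 0).
    move=> i j.
    have h0 k : ucvg (0 : R)^' G (fun h z => resolvent A (h *: v + y) z i k *
        ((A (h *: v + y) - A y) *m resolvent A y z) k j) (fun=> 0).
      apply: ucvg_bounded_mul.
        by exists C; apply: filterS nh => h hh z /hh [_]; apply.
      by apply: eq_ucvg (cB k j); [exact: filterE | move=> z _; rewrite mxE].
    apply: eq_ucvg (ucvg_sum (index_enum 'I_n) h0).
      by apply: filterS resB => h hh z /hh ->; rewrite [RHS]mxE.
    by move=> z _; rewrite mxE big1.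
  apply: eq_mx_ucvg (mx_ucvgD c0 (mx_ucvg_cst bR)).
    by apply: filterE => h z _; rewrite subrK.
  by move=> z _; rewrite add0r.
split=> //; apply: eq_mx_ucvg (mx_ucvgM (mx_ucvgM cR dA) (mx_ucvg_cst bR)) => //.
apply: filterS resB => h hh z /hh ->.
by rewrite -scalemxAr -scalemxAl mulmxA.
Qed.

End UniformDerivative.

(** * Words of resolvents and derivatives of [A] *)

Section Words.
Variables (R : realType) (r n : nat) (A : 'rV[R]_r -> 'M[R[i]]_n).

(* A word [w_1; ...; w_l] stands for R A_{w_1} R ... A_{w_l} R, where R is the
   resolvent of A and A_w the iterated partial derivative of A along w. *)
Fixpoint word_resolvent (W : seq (seq 'I_r)) x z : 'M[R[i]]_n :=
  if W is w :: W' then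
    resolvent A x z *m iter_partial w A x *m word_resolvent W' x z
  else resolvent A x z.

(** Leibniz rule: the first word differentiates the leading resolvent, the second one the leading
    letter, the others the remaining word. *)
Fixpoint word_succ (j : 'I_r) (W : seq (seq 'I_r)) : seq (seq (seq 'I_r)) :=
  if W is w :: W' then
    ([:: j] :: w :: W') :: ((j :: w) :: W') :: map (cons w) (word_succ j W')
  else [:: [:: [:: j]]].

Fixpoint words (s : seq 'I_r) : seq (seq (seq 'I_r)) :=
  if s is j :: s' then flatten (map (word_succ j) (words s')) else [:: [::]].

Lemma udiff_word G y (j : 'I_r) (C : R) W :
  (\forall x \near y, forall z, G z ->
     z%:M - A x \in unitmx /\ forall i k, nc (resolvent A x z i k) <= C) ->
  mx_derivable A y (delta_mx 0 j) ->
  (forall w, w \in W -> mx_derivable (iter_partial w A) y (delta_mx 0 j)) ->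
  udiff G (fun h => word_resolvent W (h *: delta_mx 0 j + y)) (word_resolvent W y)
    (fun z => \sum_(W' <- word_succ j W) word_resolvent W' y z).
Proof.
move=> nA dA; have uR := udiff_resolvent nA (mx_derivable_deriv dA).
elim: W => [|w W IHW] dW.
  case: uR => c d; split=> //; apply: eq_mx_ucvg d; first exact: filterE.
  by move=> z _; rewrite big_seq1.
have dw : mx_derivable (iter_partial w A) y (delta_mx 0 j).
  by apply: dW; rewrite mem_head.
have uW := IHW (fun w' hw' => dW w' (@mem_behead _ (w :: W) w' hw')).
have [c d] := udiffM (udiffM uR (udiff_const G (mx_derivable_deriv dw))) uW.
split; first exact: c.
apply: eq_mx_ucvg d; first exact: filterE.
move=> z _; rewrite /= !big_cons big_map mulmxDl -addrA /=.
rewrite -mulmx_sumr.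
move: (resolvent A y z) (word_resolvent W y z) (\sum_(_ <- _) _).
move: (partial j A y) (partial j (iter_partial w A) y) (iter_partial w A y).
by move=> X1 X2 X3 X4 X5 X6; rewrite !mulmxA.
Qed.

Lemma word_functional_deriv (G : set R[i]) L y (j : 'I_r) (C : R) W :
  bounded_functional G L ->
  (\forall x \near y, forall z, G z ->
     z%:M - A x \in unitmx /\ forall i k, nc (resolvent A x z i k) <= C) ->
  mx_derivable A y (delta_mx 0 j) ->
  (forall w, w \in W -> mx_derivable (iter_partial w A) y (delta_mx 0 j)) ->
  has_mx_deriv (fun x => mxfunctional L (word_resolvent W x)) y (delta_mx 0 j)
    (mxfunctional L (fun z => \sum_(W' <- word_succ j W) word_resolvent W' y z)).
Proof.
move=> bfL nA dA dW a b e e0; have [c d] := udiff_word nA dA dW.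
have [Mb nM] := ucvg_near_bounded (c a b); have [b0 _] := c a b.
apply: filterS2 nM (bf_cvg bfL (d a b) e0) => h hM.
congr (nc (_ - _) <= _); last by rewrite mxE.
have bh : cbounded G (fun z => word_resolvent W (h *: delta_mx 0 j + y) z a b).
  by exists Mb.
rewrite !mxE -(bf_sub bfL) // -(bf_scale bfL); last first.
  apply: eq_cbounded (cboundedD bh (cboundedM (cbounded_cst G (-1)) b0)) => z _.
  by rewrite mulN1r.
by apply: (bf_ext bfL) => z _; rewrite !mxE.
Qed.

End Words.

(** * Differentiability of order [k] and iterated partial derivatives *)

Section IteratedDerivatives.
Variables (R : realType) (r n : nat).
Implicit Types (F : 'rV[R]_r -> 'M[R[i]]_n) (x y v : 'rV[R]_r).

Lemma iter_partial_rcons s j F :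
  iter_partial (rcons s j) F = iter_partial s (partial j F).
Proof. by elim: s => [|a s IHs]; [exact: erefl | rewrite /= IHs]. Qed.

(** [times_differentiable] strips the innermost derivative, which comes last in [s]; hence the
    induction from the end of the list. *)
Lemma times_differentiable_iter k F x : times_differentiable k F x ->
  forall s, (size s < k)%N -> mx_differentiable (iter_partial s F) x /\
    ((size s).+1 < k -> \forall y \near x, mx_differentiable (iter_partial s F) y)%N.
Proof.
elim: k F => // -[_ F dF [|//] _ //|k IHk F dF s].
case/lastP: s => [_|s j].
  by case: dF => nF _; split=> // ; exact: nbhs_singleton nF.
rewrite size_rcons !ltnS => sk; case: dF => _ /(_ j) /IHk h.
by rewrite iter_partial_rcons; exact: h.
Qed.

Lemma times_differentiable_near k F x : times_differentiable k.+2 F x ->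
  \forall y \near x, times_differentiable k.+1 F y.
Proof.
elim: k F x => [|k IHk] F x [nF dF] //.
have hj j : \forall y \near x, times_differentiable k.+1 (partial j F) y.
  by apply: IHk; exact: (dF j).
have nj : \forall y \near x, forall j, times_differentiable k.+1 (partial j F) y.
  by near=> y; near: y; exact: filter_forall.
by apply: filterS2 (near_join nF) nj => y nFy h; split.
Unshelve. all: by end_near. Qed.

Lemma mx_differentiable_derivable F x j : mx_differentiable F x ->
  mx_derivable F x (delta_mx 0 j).
Proof. by move=> [dR dI]; split; exact: diff_derivable. Qed.

Lemma mx_differentiable_near F x : mx_differentiable F x ->
  forall e : R, 0 < e -> \forall y \near x, forall i j, nc (F y i j - F x i j) <= e.
Proof.
move=> [/differentiable_continuous cR /differentiable_continuous cI] e e0.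
have e2 : 0 < e / 2 by rewrite divr_gt0.
have /cvg_mxP hR : Re_mx F y @[y --> x] --> Re_mx F x by exact: cR.
have /cvg_mxP hI : Im_mx F y @[y --> x] --> Im_mx F x by exact: cI.
have hh (ij : 'I_n * 'I_n) : \forall y \near x, nc (F y ij.1 ij.2 - F x ij.1 ij.2) <= e.
  have /cvgrPdist_le/(_ _ e2) h1 := hR ij.1 ij.2.
  have /cvgrPdist_le/(_ _ e2) h2 := hI ij.1 ij.2.
  apply: filterS2 h1 h2 => y; rewrite !mxE ncC.
  move: (F x _ _) (F y _ _) => [a b] [c d] /= h1 h2.
  by apply: le_trans (nc_le_ReIm _) _; rewrite [leRHS]splitr lerD.
near=> y => i j.
suff : nc (F y (i, j).1 (i, j).2 - F x (i, j).1 (i, j).2) <= e by [].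
by move: (i, j); near: y; apply: filter_forall.
Unshelve. all: by end_near. Qed.

Lemma has_mx_deriv_sum (I : eqType) (s : seq I) (F : I -> 'rV[R]_r -> 'M[R[i]]_n)
    y v (M : I -> 'M[R[i]]_n) :
  (forall i, i \in s -> has_mx_deriv (F i) y v (M i)) ->
  has_mx_deriv (fun x => \sum_(i <- s) F i x) y v (\sum_(i <- s) M i).
Proof.
elim: s => [|i s IHs] h a b e e0.
  apply: filterE => x; rewrite /diff_quotient !big_nil subrr scaler0 !mxE.
  by rewrite subrr nc0 ltW.
have e2 : 0 < e / 2 by rewrite divr_gt0.
have h1 := h i (mem_head _ _) a b _ e2.
have h2 := IHs (fun k ks => h k (@mem_behead _ (i :: s) k ks)) a b _ e2.
apply: filterS2 h1 h2 => x h1 h2; rewrite /diff_quotient !big_cons.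
rewrite opprD addrACA scalerDr [X in X - _]mxE [X in _ - X]mxE opprD addrACA.
by apply: le_trans (ncD _ _) _; rewrite [leRHS]splitr lerD.
Qed.

End IteratedDerivatives.

Section WordExpansion.
Variables (R : realType) (r n k : nat) (A fA : 'rV[R]_r -> 'M[R[i]]_n).
Variables (x0 : 'rV[R]_r) (G : set R[i]) (L : (R[i] -> R[i]) -> R[i]) (C : R).
Hypothesis bfL : bounded_functional G L.
Hypothesis A_diff : times_differentiable k A x0.
Hypothesis A_res : \forall x \near x0, forall z, G z ->
  z%:M - A x \in unitmx /\ forall i j, nc (resolvent A x z i j) <= C.
Hypothesis fA_eq : \forall x \near x0, fA x = mxfunctional L (resolvent A x).

Definition word_expansion s x := has_iter_partial s fA x /\
  iter_partial s fA x = \sum_(W <- words s) mxfunctional L (word_resolvent A W x).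

Lemma mem_word_succ (j : 'I_r) W w : forall W', W' \in word_succ j W -> w \in W' ->
  exists2 w0, (w0 \in W) || (w0 == [::]) & (w = w0) \/ (w = j :: w0).
Proof.
elim: W => [|u W IHW] W' /=.
  by rewrite inE => /eqP ->; rewrite inE => /eqP ->; exists [::] => //; right.
rewrite !inE => /or3P[/eqP ->|/eqP ->|/mapP[W'' /IHW h ->]]; rewrite !inE.
- case/or3P=> [/eqP ->|/eqP ->|wW]; first by exists [::]; [rewrite eqxx orbT | right].
    by exists u; [rewrite inE eqxx | left].
  by exists w; [rewrite inE wW !orbT | left].
- case/orP=> [/eqP ->|wW]; first by exists u; [rewrite inE eqxx | right].
  by exists w; [rewrite inE wW !orbT | left].
case/orP=> [/eqP ->|/h [w0 h0 hw]]; first by exists u; [rewrite inE eqxx | left].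
by exists w0 => //; rewrite inE -orbA h0 orbT.
Qed.

(** Bounds the order of the derivatives of [A] that occur, and makes each letter inherit the order
    of the directions in [s]. *)
Lemma mem_words_subseq (s : seq 'I_r) W w : W \in words s -> w \in W -> subseq w s.
Proof.
elim: s W w => [|j s IHs] W w /=; first by rewrite inE => /eqP ->.
move=> /flattenP [_ /mapP [W0 W0s ->] WW0] wW.
have [w0 h0 hw] := mem_word_succ WW0 wW.
have sw0 : subseq w0 s by case/orP: h0 => [/(IHs _ _ W0s)//|/eqP ->]; exact: sub0seq.
case: hw => ->; last by rewrite /= eqxx.
exact: subseq_trans sw0 (subseq_cons _ _).
Qed.

Lemma word_resolvent_bounded x W :
  (forall z, G z -> z%:M - A x \in unitmx /\
     forall i j, nc (resolvent A x z i j) <= C) ->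
  mx_cbounded G (word_resolvent A W x).
Proof.
move=> h; have bR : mx_cbounded G (resolvent A x).
  by move=> i j; exists C => z /h [_]; apply.
elim: W => //= w W IHW.
exact: mx_cbounded_mul (mx_cbounded_mul bR (mx_cbounded_cst _ _)) IHW.
Qed.

Lemma word_expansion_step j s y :
  (\forall x \near y, forall z, G z ->
     z%:M - A x \in unitmx /\ forall i k, nc (resolvent A x z i k) <= C) ->
  (forall w, (size w <= size s)%N -> mx_differentiable (iter_partial w A) y) ->
  (\forall x \near y, word_expansion s x) -> word_expansion (j :: s) y.
Proof.
move=> nA dA hs; rewrite /word_expansion /=.
have dA0 : mx_derivable A y (delta_mx 0 j).
  exact: mx_differentiable_derivable (dA [::] isT).
have hd : has_mx_deriv (iter_partial s fA) y (delta_mx 0 j)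
    (\sum_(W <- words s) mxfunctional L
       (fun z => \sum_(W' <- word_succ j W) word_resolvent A W' y z)).
  apply: near_eq_has_mx_deriv (has_mx_deriv_sum _).
    by apply: filterS hs => x [_ ->].
  move=> W Ws /=; apply: word_functional_deriv bfL nA dA0 _ => w wW.
  apply: mx_differentiable_derivable; apply: dA.
  exact: size_subseq (mem_words_subseq Ws wW).
have [hd1 hd2] := has_mx_deriv_derivable hd; split.
  by split=> //; apply: filterS hs => x [].
rewrite hd2 big_flatten /= big_map; apply: eq_bigr => W _.
rewrite (mxfunctional_sum bfL) // => W'.
exact: word_resolvent_bounded (nbhs_singleton nA).
Qed.

(** Derivatives of [A] of order [k] are available at [x0] only. The expansion is therefore proved at
    [x0] up to order [k] and near [x0] below [k], the latter being what the next derivative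
    needs. *)
Lemma iter_partial_functional s : (size s <= k)%N -> (0 < k)%N ->
  word_expansion s x0 /\
  ((size s < k)%N -> \forall x \near x0, word_expansion s x).
Proof.
move=> + k0; have dA w := times_differentiable_iter A_diff (s := w).
elim: s => [|j s IHs] sk.
  have h : \forall x \near x0, word_expansion [::] x.
    by apply: filterS fA_eq => x fx; split=> //=; rewrite big_seq1.
  by split=> [|_]; [exact: nbhs_singleton h | exact: h].
have [_ /(_ sk) hs] := IHs (ltnW sk); split.
  apply: word_expansion_step => // w ws.
  by have [] := dA w (leq_ltn_trans ws sk).
move=> sk1.
have [k' kE] : exists k', k = k'.+2.
  by exists k.-2; move: sk1 => /=; lia.
move: A_diff; rewrite kE => /times_differentiable_near nA.
apply: filterS3 (near_join A_res) nA (near_join hs) => y rA dAy hy.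
apply: word_expansion_step => // w ws.
have [] // := times_differentiable_iter dAy (s := w).
by apply: leq_ltn_trans ws _; move: sk1; rewrite kE.
Qed.

End WordExpansion.

(** * Divided differences as values of the functional on products of poles *)

Section DividedDifferences.
Variables (R : realType) (G : set R[i]) (L : (R[i] -> R[i]) -> R[i]).
Variables (f : R[i]^o -> R[i]^o) (cs : seq R[i]) (rad : R).
Hypothesis bfL : bounded_functional G L.
Hypothesis rad0 : 0 < rad.
Hypothesis far : forall z c, G z -> c \in cs -> rad <= nc (z - c).
Hypothesis pole : forall c p, c \in cs ->
  L (fun z => (z - c)^-1 ^+ p.+1) = derive1n p f c / p`!%:R.

(** Equal end points then force all points to be equal, the case in which [divdiff_rec] takes a
    derivative. Both sublists of the recursion inherit the property. *)
Definition contiguous (s : seq R[i]) := forall a b c, (a <= b <= c)%N ->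
  (c < size s)%N -> s`_a = s`_c -> s`_b = s`_a.

Lemma contiguous_behead s : contiguous s -> contiguous (behead s).
Proof.
move=> h a b c abc; rewrite size_behead => cs'; rewrite !nth_behead => e.
by apply: h e; lia.
Qed.

Lemma contiguous_take l s : contiguous s -> contiguous (take l s).
Proof.
move=> h a b c /andP[ab bc]; rewrite size_take_min leq_min => /andP[cl cz].
rewrite !nth_take ?(leq_ltn_trans _ cl) //; last exact: leq_trans bc.
by apply: h; rewrite ?ab.
Qed.

Definition pole_prod (s : seq R[i]) z : R[i] := \prod_(a <- s) (z - a)^-1.

Lemma pole_prod_bounded s : {subset s <= cs} -> cbounded G (pole_prod s).
Proof.
rewrite /pole_prod; elim: s => [|a s IHs] hs.
  by under eq_fun do rewrite big_nil; exact: cbounded_cst.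
under eq_fun do rewrite big_cons; apply: cboundedM; last first.
  by apply: IHs => b bs; apply: hs; rewrite inE bs orbT.
exists rad^-1 => z Gz; have h := far Gz (hs a (mem_head _ _)).
by rewrite ncV lef_pV2 ?posrE // (lt_le_trans _ h).
Qed.

(** The recursion is the identity [(b - a) / ((z - a) (z - b)) = 1 / (z - b) - 1 / (z - a)]
    multiplied by the other poles; the confluent case is the value of [L] on a multiple pole. *)
Lemma divdiff_rec_functional l s : size s = l.+1 -> contiguous s ->
  {subset s <= cs} -> L (pole_prod s) = divdiff_rec f l s.
Proof.
elim: l s => [|l IHl] s sz hs scs.
  case: s sz hs scs => [|a [|b s]] // _ _ scs /=.
  have := pole 0 (scs a (mem_head _ _)); rewrite fact0 divr1 /= => <-.
  by apply: (bf_ext bfL) => z _; rewrite /pole_prod big_seq1 expr1.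
rewrite /=; set a := head 0 s; set b := last 0 s.
have aE : a = s`_0 by rewrite /a nth0.
have bE : b = s`_(l.+1) by rewrite /b -nth_last sz.
have ain : a \in cs by apply: scs; rewrite aE mem_nth // sz.
have bin : b \in cs by apply: scs; rewrite bE mem_nth // sz.
have [ab|ab] := eqVneq a b.
  have -> : s = nseq l.+2 a.
    apply: (@eq_from_nth _ 0); rewrite ?size_nseq // sz => p pl.
    rewrite nth_nseq pl aE; apply: (hs 0%N p l.+1); rewrite ?sz //.
    by rewrite -aE -bE.
  have /= <- := pole l.+1 ain; apply: (bf_ext bfL) => z _.
  by rewrite /pole_prod -[[:: a, a & _]]/(nseq l.+2 a) big_nseq iter_mulr_1.
have sb : size (behead s) = l.+1 by rewrite size_behead sz.
have st : size (take l.+1 s) = l.+1 by rewrite size_takel // sz.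
have subb : {subset behead s <= cs} by move=> c /mem_behead /scs.
have subt : {subset take l.+1 s <= cs} by move=> c /mem_take /scs.
rewrite -(IHl _ sb (contiguous_behead hs) subb).
rewrite -(IHl _ st (contiguous_take hs) subt).
have ba0 : b - a != 0 by rewrite subr_eq0 eq_sym.
apply: (mulIf ba0); rewrite divfK // mulrC.
have bs := pole_prod_bounded scs; have bb := pole_prod_bounded subb.
have bt := pole_prod_bounded subt.
rewrite -(bf_scale bfL) // -(bf_sub bfL) //.
apply: (bf_ext bfL) => z Gz.
have za : z - a != 0 by rewrite -nc_gt0 (lt_le_trans rad0) ?far.
have zb : z - b != 0 by rewrite -nc_gt0 (lt_le_trans rad0) ?far.
have E1 : pole_prod s z = (z - a)^-1 * pole_prod (behead s) z.
  by rewrite /a; case: (s) sz => // c s' _; rewrite /pole_prod big_cons.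
have E2 : pole_prod s z = (z - b)^-1 * pole_prod (take l.+1 s) z.
  rewrite -{1}(cat_take_drop l.+1 s) (drop_nth 0) ?sz // drop_oversize ?sz //.
  by rewrite -bE cats1 /pole_prod -[rcons _ _]cats1 big_cat big_seq1 mulrC.
have -> : pole_prod (behead s) z = (z - a) * pole_prod s z.
  by rewrite E1 mulVKf.
have -> : pole_prod (take l.+1 s) z = (z - b) * pole_prod s z.
  by rewrite E2 mulVKf.
by ring.
Qed.

Lemma perm_group_points (s : seq R[i]) : perm_eq (group_points s) s.
Proof.
apply/allP => a _ /=; apply/eqP; rewrite /group_points count_flatten -map_comp.
rewrite (eq_map (g := fun z => if z == a then count_mem z s else 0%N)); last first.
  by move=> z /=; rewrite count_nseq /=; case: eqP; rewrite ?mul1n ?mul0n.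
rewrite sumnE big_map -big_mkcond.
have [as_|as_] := boolP (a \in s).
  rewrite -big_filter (filter_pred1_uniq (undup_uniq s)) ?mem_undup //.
  by rewrite big_seq1.
rewrite big_seq_cond big1 => [|z /andP[]]; first by rewrite (count_memPn as_).
by rewrite mem_undup => zs /eqP za; rewrite -za zs in as_.
Qed.

Lemma contiguous_group (us : seq R[i]) (m : R[i] -> nat) : uniq us ->
  contiguous (flatten [seq nseq (m z) z | z <- us]).
Proof.
elim: us => [_ a b c //|u us IHus] /= /andP[uus /IHus h] a b c /andP[ab bc].
rewrite size_cat size_nseq => cs'; rewrite !nth_cat !size_nseq !nth_nseq.
have nu p : (p < size (flatten [seq nseq (m z) z | z <- us]))%N ->
    (flatten [seq nseq (m z) z | z <- us])`_p <> u.
  move=> pl E; move: uus; rewrite -E; apply/negP; rewrite negbK.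
  have /flattenP [_ /mapP [z zus ->]] := mem_nth 0 pl.
  by rewrite mem_nseq => /andP[_ /eqP ->].
case: (ltnP c (m u)) => cm.
  by rewrite (leq_ltn_trans bc cm) (leq_ltn_trans (leq_trans ab bc) cm).
have cl : (c - m u < size (flatten [seq nseq (m z) z | z <- us]))%N by lia.
case: (ltnP a (m u)) => am; first by move/esym/nu => /(_ cl).
rewrite ltnNge (leq_trans am ab) /= => e.
by apply: (h _ _ _ _ cl e); lia.
Qed.

Lemma divdiff_functional s : s != [::] -> {subset s <= cs} ->
  L (pole_prod s) = divdiff f s.
Proof.
move=> s0 scs; have p := perm_group_points s.
rewrite /divdiff -divdiff_rec_functional.
- by apply: (bf_ext bfL) => z _; apply: perm_big; rewrite perm_sym.
- by rewrite (perm_size p); case: (s) s0.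
- by apply: contiguous_group; exact: undup_uniq.
by move=> c; rewrite (perm_mem p); exact: scs.
Qed.

End DividedDifferences.

(** * Ordered partitions of multi-indices *)

Section OrderedPartitions.
Variables (T : Type) (x0 : T).
Implicit Types (V u : seq T) (e : T).

Definition insert_at q e V := take q V ++ e :: drop q V.

Definition perm_seq l u (p : 'S_l) : seq T := [seq nth x0 u (p i) | i <- enum 'I_l].

Lemma size_perm_seq l u (p : 'S_l) : size (perm_seq u p) = l.
Proof. by rewrite size_map size_enum_ord. Qed.

Lemma nth_perm_seq l u (p : 'S_l) (i : 'I_l) : nth x0 (perm_seq u p) i = nth x0 u (p i).
Proof. by rewrite (nth_map i) ?size_enum_ord // nth_ord_enum. Qed.

(** A permutation of [l.+1] indices amounts to the index [q] sent to the last one and a permutation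
    of the others. Appending a part before permuting thus becomes inserting it at every position
    afterwards. *)
Lemma lift_perm_bij l :
  bijective (fun qp : 'I_l.+1 * 'S_l => lift_perm qp.1 ord_max qp.2).
Proof.
apply: inj_card_bij; last first.
  by rewrite card_prod !card_Sn card_ord factS.
move=> [q p] [q' p'] /= E; have qq : q = q'.
  apply: (@perm_inj _ (lift_perm q ord_max p)).
  by rewrite {2}E !lift_perm_id.
rewrite -qq in E *; congr (_, _); apply/permP => i.
by have := congr1 (fun s : 'S_l.+1 => s (lift q i)) E; rewrite !lift_perm_lift => /lift_inj.
Qed.

Lemma perm_seq_lift l u e (q : 'I_l.+1) (p : 'S_l) : size u = l ->
  perm_seq (rcons u e) (lift_perm q ord_max p) = insert_at q e (perm_seq u p).
Proof.
move=> su; have ql : (q <= l)%N by rewrite -ltnS.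
have st : size (take q (perm_seq u p)) = q by rewrite size_takel ?size_perm_seq.
apply: (@eq_from_nth _ x0).
  rewrite size_perm_seq /insert_at size_cat /= st size_drop size_perm_seq; lia.
rewrite size_perm_seq => i0 il0.
suff h (i : 'I_l.+1) : nth x0 (perm_seq (rcons u e) (lift_perm q ord_max p)) i =
    nth x0 (insert_at q e (perm_seq u p)) i by exact: (h (Ordinal il0)).
rewrite nth_perm_seq /insert_at nth_cat st.
case: (unliftP q i) => [k|] ->.
  rewrite lift_perm_lift nth_rcons su lift_max ltn_ord /= /bump.
  have [qk|kq] := leqP q k; last by rewrite add0n kq nth_take // nth_perm_seq.
  by rewrite add1n ltnNge leqW // subSn //= nth_drop subnKC // nth_perm_seq.
by rewrite lift_perm_id nth_rcons su ltnn eqxx ltnn subnn.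
Qed.

Lemma sum_perm_rcons (M : zmodType) l u e (F : seq T -> M) : size u = l ->
  \sum_(p : 'S_l.+1) F (perm_seq (rcons u e) p) =
  \sum_(p : 'S_l) \sum_(q < l.+1) F (insert_at q e (perm_seq u p)).
Proof.
move=> su; rewrite exchange_big pair_bigA /=.
rewrite (reindex _ (onW_bij _ (lift_perm_bij l))) /=.
by apply: eq_bigr => -[q p] _; rewrite perm_seq_lift.
Qed.

Lemma perm_seq_set_nth l u (p : 'S_l) (q : 'I_l) (g : T -> T) : size u = l ->
  perm_seq (set_nth x0 u (p q) (g (nth x0 u (p q)))) p =
  set_nth x0 (perm_seq u p) q (g (nth x0 (perm_seq u p) q)).
Proof.
move=> su; apply: (@eq_from_nth _ x0).
  by rewrite size_set_nth !size_perm_seq; apply/esym/maxn_idPr.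
rewrite size_perm_seq => i0 il0.
suff h (i : 'I_l) : nth x0 (perm_seq (set_nth x0 u (p q) (g (nth x0 u (p q)))) p) i =
    nth x0 (set_nth x0 (perm_seq u p) q (g (nth x0 (perm_seq u p) q))) i.
  exact: (h (Ordinal il0)).
rewrite nth_perm_seq !nth_set_nth /= !nth_perm_seq.
by rewrite !(inj_eq val_inj) (inj_eq perm_inj).
Qed.

(** For fixed [p], the index of the modified part is reindexed by [p]: changing a part before
    permuting becomes changing an entry afterwards. *)
Lemma sum_perm_set_nth (M : zmodType) l u (g : T -> T) (F : seq T -> M) :
  size u = l ->
  \sum_(q < l) \sum_(p : 'S_l) F (perm_seq (set_nth x0 u q (g (nth x0 u q))) p) =
  \sum_(p : 'S_l) \sum_(q < l)
    F (set_nth x0 (perm_seq u p) q (g (nth x0 (perm_seq u p) q))).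
Proof.
move=> su; rewrite exchange_big; apply: eq_bigr => p _.
rewrite (reindex_inj (@perm_inj _ p)) /=; apply: eq_bigr => q _.
by rewrite perm_seq_set_nth.
Qed.

End OrderedPartitions.

Section WordsPartitions.
Variables (r : nat) (M : zmodType).
Implicit Types (F : seq (mindex r) -> M) (V : seq (mindex r)) (e : mindex r)
  (s : seq 'I_r).

Definition word_sum (w : seq 'I_r) : mindex r := \sum_(i <- w) mi_unit i.

(** What [word_succ] becomes when each letter is replaced by its multi-index. *)
Fixpoint mi_succ e V : seq (seq (mindex r)) :=
  if V is v :: V' then
    (e :: v :: V') :: ((e + v) :: V') :: map (cons v) (mi_succ e V')
  else [:: [:: e]].

Fixpoint mi_words (s : seq 'I_r) : seq (seq (mindex r)) :=
  if s is j :: s' then flatten (map (mi_succ (mi_unit j)) (mi_words s'))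
  else [:: [::]].

Lemma word_succ_sum j W :
  map (map word_sum) (word_succ j W) = mi_succ (mi_unit j) (map word_sum W).
Proof.
elim: W => [|w W IHW] /=; first by rewrite /word_sum big_seq1.
rewrite -IHW -!map_comp; congr [:: _, _ & _]; first by rewrite {1}/word_sum big_seq1.
by rewrite {1}/word_sum big_cons.
Qed.

Lemma words_sum s : map (map word_sum) (words s) = mi_words s.
Proof.
elim: s => //= j s IHs; rewrite map_flatten -map_comp -IHs -map_comp.
by congr flatten; apply: eq_map => W /=; rewrite word_succ_sum.
Qed.

Lemma sum_mi_succ F e V :
  \sum_(V' <- mi_succ e V) F V' =
  \sum_(q < (size V).+1) F (insert_at q e V) +
  \sum_(q < size V) F (set_nth 0 V q (V`_q + e)).
Proof.
elim: V F => [|v V IHV] F /=.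
  by rewrite big_seq1 big_ord_recl !big_ord0 !addr0.
rewrite !big_cons big_map (IHV (fun V => F (v :: V))).
rewrite [X in _ = X + _]big_ord_recl [X in _ = _ + X]big_ord_recl /=.
rewrite -!addrA [e + v]addrC; congr (_ + _).
by rewrite addrCA; congr (_ + (_ + _)).
Qed.

Lemma size_mi_partitions s l u : u \in mi_partitions_rec s l -> size u = l.
Proof.
elim: s l u => // j s IHs l u /=; case: eqP => // /eqP l0.
case: eqP => [->|_]; first by rewrite inE => /eqP ->.
case: ltnP => // _; rewrite mem_cat => /orP[/mapP[u' /IHs su ->]|].
  by rewrite size_rcons su prednK // lt0n.
case/allpairsP => -[u' q] /= [/IHs su]; rewrite mem_iota add0n => /andP[_ ql] ->.
by rewrite size_set_nth su; apply/maxn_idPr.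
Qed.

Lemma mi_partitions_0 s : mi_partitions_rec s 0 = [::].
Proof. by case: s. Qed.

Lemma mi_partitions_large s l : (size s < l)%N -> mi_partitions_rec s l = [::].
Proof. by case: s l => [|j s] [|[|l]] //=; rewrite !ltnS => ->. Qed.

(** Extends the defining recursion to [l = 1], where the first sum on the right is empty, and to [l]
    beyond the size, where all sums are empty. *)
Lemma sum_mi_partitions j s l F : s != [::] -> (0 < l)%N ->
  \sum_(u <- mi_partitions_rec (j :: s) l) F u =
  \sum_(u <- mi_partitions_rec s l.-1) F (rcons u (mi_unit j)) +
  \sum_(u <- mi_partitions_rec s l) \sum_(q < l) F (set_nth 0 u q (u`_q + mi_unit j)).
Proof.
move=> s0 l0; case: l l0 => [//|[|l]] _.
  rewrite /= mi_partitions_0 big_nil add0r big_seq1.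
  case: s s0 => // i s _; rewrite /= !big_seq1 big_ord1 /=.
  by rewrite [in LHS]big_cons addrC.
case: (ltnP (size (j :: s)) l.+2) => sl.
  rewrite !mi_partitions_large ?big_nil ?addr0 //; move: sl => /=; lia.
have -> : mi_partitions_rec (j :: s) l.+2 =
    [seq rcons u (mi_unit j) | u <- mi_partitions_rec s l.+1] ++
    [seq set_nth 0 u q (u`_q + mi_unit j)
       | u <- mi_partitions_rec s l.+2, q <- iota 0 l.+2].
  by rewrite /= ltnNge sl.
rewrite big_cat big_map big_allpairs_dep; congr (_ + _).
apply: eq_bigr => u _.
by rewrite -[iota _ _]/(index_iota 0 l.+2) big_mkord.
Qed.

(** Insertions into ordered tuples match the new parts of the recursion for partitions, additions to
    an entry match the enlarged parts. The empty list is excluded: it has the empty word but no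
    partition. *)
Lemma sum_mi_words s F : s != [::] ->
  \sum_(V <- mi_words s) F V =
  \sum_(1 <= l < (size s).+1) \sum_(u <- mi_partitions_rec s l)
    \sum_(p : 'S_l) F (perm_seq 0 u p).
Proof.
elim: s F => // j s IHs F _; have [->|s0] := eqVneq s [::].
  rewrite /= !big_seq1 /=.
  rewrite -[[:: _]]/(rcons [::] _) sum_perm_rcons //.
  rewrite (big_pred1 1%g) => [|p]; first by rewrite big_ord1 /= /perm_seq /insert_at enum_ord0.
  by apply/esym/eqP/permP => -[].
rewrite [mi_words _]/= big_flatten big_map.
under eq_bigr do rewrite sum_mi_succ.
rewrite (IHs (fun V => \sum_(q < (size V).+1) F (insert_at q (mi_unit j) V) +
  \sum_(q < size V) F (set_nth 0 V q (V`_q + mi_unit j)))) //.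
transitivity (\sum_(1 <= l < (size s).+1)
  (\sum_(u <- mi_partitions_rec s l) \sum_(p : 'S_l.+1) F (perm_seq 0 (rcons u (mi_unit j)) p)
  + \sum_(u <- mi_partitions_rec s l) \sum_(q < l) \sum_(p : 'S_l)
       F (perm_seq 0 (set_nth 0 u q (u`_q + mi_unit j)) p))).
  apply: eq_bigr => l _; rewrite -big_split /= big_seq [RHS]big_seq.
  apply: eq_bigr => u /size_mi_partitions su.
  rewrite sum_perm_rcons // (@sum_perm_set_nth _ 0 M l u (fun v => v + mi_unit j) F su).
  by rewrite -big_split /=; apply: eq_bigr => p _; rewrite size_perm_seq.
rewrite big_split /=.
(* The first sum is shifted by one, its new term at [l = 1] being empty; the second one receives an
   empty last term. *)
transitivity (\sum_(1 <= l < (size s).+2)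
  (\sum_(u <- mi_partitions_rec s l.-1)
     \sum_(p : 'S_l) F (perm_seq 0 (rcons u (mi_unit j)) p)
  + \sum_(u <- mi_partitions_rec s l) \sum_(q < l) \sum_(p : 'S_l)
       F (perm_seq 0 (set_nth 0 u q (u`_q + mi_unit j)) p))).
  rewrite [RHS]big_split /=; congr (_ + _).
    rewrite [RHS]big_add1 /= [RHS]big_ltn // mi_partitions_0 big_nil add0r.
    by [].
  rewrite [RHS]big_nat_recr //= mi_partitions_large ?big_nil ?addr0 //.
apply: eq_big_nat => l /andP[l0 _].
by rewrite -(sum_mi_partitions j (fun u => \sum_(p : 'S_l) F (perm_seq 0 u p))).
Qed.

Lemma sum_words (s : seq 'I_r) F : s != [::] ->
  \sum_(W <- words s) F (map word_sum W) =
  \sum_(1 <= l < (size s).+1) \sum_(u <- mi_partitions_rec s l)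
    \sum_(p : 'S_l) F (perm_seq 0 u p).
Proof. by move=> s0; rewrite -sum_mi_words // -words_sum big_map. Qed.

Definition ord_leq (i j : 'I_r) := (i <= j)%N.

Lemma sorted_mi_dirs (a : mindex r) : sorted ord_leq (mi_dirs a).
Proof.
have tr : transitive ord_leq by move=> x y z; exact: leq_trans.
rewrite (sorted_pairwise tr) /mi_dirs.
have : pairwise (fun i j : 'I_r => (i < j)%N) (enum 'I_r).
  rewrite -(pairwise_map val ltn) val_enum_ord.
  by rewrite -(sorted_pairwise ltn_trans) iota_ltn_sorted.
elim: (enum 'I_r) => //= i s IHs /andP[is_ /IHs ps].
rewrite pairwise_cat ps andbT; apply/andP; split.
  apply/allrelP => x y; rewrite mem_nseq => /andP[_ /eqP ->].
  move=> /flattenP [_ /mapP [k ks ->]]; rewrite mem_nseq => /andP[_ /eqP ->].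
  by apply: ltnW; exact: (allP is_).
by rewrite -(sorted_pairwise tr); elim: (a i) => //= -[|m] //= IH; rewrite IH /ord_leq leqnn.
Qed.

Lemma word_sumE (w : seq 'I_r) i : (word_sum w) i = count_mem i w.
Proof.
rewrite /word_sum; elim: w => [|j w IHw]; first by rewrite big_nil ffunE.
by rewrite big_cons ffunE IHw ffunE /= eq_sym.
Qed.

(** A sorted list is determined by its multiplicities. Derivatives along a sorted letter are thus
    literally [mi_partial], and partial derivatives never have to be commuted. *)
Lemma mi_dirs_word_sum (w : seq 'I_r) : sorted ord_leq w -> mi_dirs (word_sum w) = w.
Proof.
move=> sw; apply: (@sorted_eq _ ord_leq) => //.
- by move=> x y z; exact: leq_trans.
- by move=> x y xyx; apply/val_inj/eqP; rewrite eqn_leq.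
- exact: sorted_mi_dirs.
by apply/allP => i _ /=; rewrite -!word_sumE /word_sum mi_dirsK.
Qed.

End WordsPartitions.

(** * Evaluation in the eigenbasis *)

Section PathExpansion.
Variables (R : realType) (r n : nat) (A : 'rV[R]_r -> 'M[R[i]]_n) (x0 : 'rV[R]_r).
Variables (lam : 'rV[R[i]]_n) (Q : 'M[R[i]]_n).
Hypothesis Q_unitary : Q \is unitarymx.
Hypothesis A_diag : Q^t* *m A x0 *m Q = diag_mx lam.

Lemma resolvent_diag z : (forall i, z != lam 0 i) ->
  resolvent A x0 z = Q *m diag_mx (\row_i (z - lam 0 i)^-1) *m Q^t*.
Proof.
move=> hz; have VQ := unitary_mulVmx Q_unitary; have QQ := unitarymxP Q_unitary.
suff h : (z%:M - A x0) *m (Q *m diag_mx (\row_i (z - lam 0 i)^-1) *m Q^t*) = 1%:M.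
  have [u _] := mulmx1_unit h.
  by rewrite /resolvent -[RHS](mulKmx u) h mulmx1.
rewrite (conj_resolvent Q_unitary A_diag (A x0)) subrr mulmx0 mul0mx addr0.
rewrite -!mulmxA (mulmxA (Q^t*) Q) VQ mul1mx (mulmxA (z%:M - _)).
suff -> : (z%:M - diag_mx lam) *m diag_mx (\row_i (z - lam 0 i)^-1) = 1%:M.
  by rewrite mul1mx.
rewrite -diag_const_mx -raddfB /= mulmx_diag; apply/matrixP => i j.
rewrite !mxE; case: eqVneq => // ->; rewrite mulfV //.
by rewrite subr_eq0 hz.
Qed.

Let U w := Q^t* *m iter_partial w A x0 *m Q.

(** [d] is a default for [nth], never reached when [p] has [(size W).+1] entries. *)
Definition path_prod d (W : seq (seq 'I_r)) (p : seq 'I_n) : R[i] :=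
  \prod_(a < size W) U (nth [::] W a) (nth d p a) (nth d p a.+1).

Lemma big_cons_tuple (M : zmodType) l (F : l.+1.-tuple 'I_n -> M) :
  \sum_(c : l.+1.-tuple 'I_n) F c =
  \sum_(a : 'I_n) \sum_(c : l.-tuple 'I_n) F [tuple of a :: c].
Proof.
rewrite pair_bigA /=.
rewrite (reindex (fun ac : 'I_n * l.-tuple 'I_n => [tuple of ac.1 :: ac.2])) //.
exists (fun c => (thead c, [tuple of behead c])) => [[a c] _ | c _] /=.
  by congr (_, _); apply: val_inj.
by rewrite [RHS]tuple_eta.
Qed.

Lemma word_resolvent_path z w W i j d : (forall i, z != lam 0 i) ->
  (Q^t* *m word_resolvent A (w :: W) x0 z *m Q) i j =
  \sum_(c : (size W).-tuple 'I_n)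
    path_prod d (w :: W) (i :: rcons c j) *
    pole_prod [seq lam 0 q | q <- i :: rcons c j] z.
Proof.
move=> hz; have VQ := unitary_mulVmx Q_unitary; have QQ := unitarymxP Q_unitary.
pose D := diag_mx (\row_i (z - lam 0 i)^-1).
have step v X : Q^t* *m (resolvent A x0 z *m iter_partial v A x0 *m X) *m Q =
    D *m U v *m (Q^t* *m X *m Q).
  rewrite resolvent_diag // -/D /U; move: (iter_partial v A x0) (D) => Y E.
  rewrite !mulmxA VQ mul1mx -!mulmxA; congr (_ *m (_ *m (_ *m _))).
  by rewrite !mulmxA QQ mul1mx.
elim: W w i => [|w' W IHW] w i.
  rewrite /= step resolvent_diag // -/D.
  rewrite [Q^t* *m _ *m Q](_ : _ = D); last first.
    by rewrite !mulmxA VQ mul1mx -mulmxA VQ mulmx1.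
  rewrite (big_pred1 [tuple]) => [|c]; last first.
    by apply/esym/eqP/val_inj; case: c => -[].
  rewrite /path_prod /pole_prod big_ord1 /= !big_cons big_nil mulr1.
  by move: (U w) => Uw; rewrite mul_mx_diag [LHS]mxE mul_diag_mx !mxE; ring.
rewrite [word_resolvent _ _ _ _]/= step mxE big_cons_tuple.
apply: eq_bigr => k _.
have -> : (D *m U w) i k = (z - lam 0 i)^-1 * U w i k.
  by move: (U w) => Uw; rewrite mul_diag_mx !mxE.
have := IHW w' k; rewrite [word_resolvent _ _ _ _]/= => ->.
rewrite mulr_sumr; apply: eq_bigr => c _.
rewrite /path_prod /pole_prod [in RHS]big_ord_recl /= [in RHS]big_cons.
by rewrite /=; ring.
Qed.

Lemma word_functional_path (G : set R[i]) L (f : R[i]^o -> R[i]^o)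
    (cs : seq R[i]) rad w W i j d :
  bounded_functional G L -> 0 < rad -> (forall i, lam 0 i \in cs) ->
  (forall z c, G z -> c \in cs -> rad <= nc (z - c)) ->
  (forall c p, c \in cs ->
    L (fun z => (z - c)^-1 ^+ p.+1) = derive1n p f c / p`!%:R) ->
  mx_cbounded G (word_resolvent A (w :: W) x0) ->
  (Q^t* *m mxfunctional L (word_resolvent A (w :: W) x0) *m Q) i j =
  \sum_(c : (size W).-tuple 'I_n)
    path_prod d (w :: W) (i :: rcons c j) *
    divdiff f [seq lam 0 q | q <- i :: rcons c j].
Proof.
move=> bfL rad0 lamcs far pole bW.
have bQ : mx_cbounded G (fun z => Q^t* *m word_resolvent A (w :: W) x0 z).
  exact: mx_cbounded_mul (mx_cbounded_cst _ _) bW.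
rewrite -(mxfunctional_mull bfL) // -(mxfunctional_mulr bfL) // mxE.
have sub (p : seq 'I_n) : {subset [seq lam 0 q | q <- p] <= cs}.
  by move=> a /mapP [q _ ->].
have bp (p : seq 'I_n) : cbounded G (pole_prod [seq lam 0 q | q <- p]).
  by apply: pole_prod_bounded rad0 far _ (sub p).
rewrite (bf_ext bfL (psi := fun z => \sum_(c : (size W).-tuple 'I_n)
    path_prod d (w :: W) (i :: rcons c j) *
    pole_prod [seq lam 0 q | q <- i :: rcons c j] z)); last first.
  move=> z Gz; apply: word_resolvent_path => k; have := far z _ Gz (lamcs k).
  by apply: contraTneq => ->; rewrite subrr nc0 -ltNge.
rewrite (bf_sum bfL) => [|c]; last exact: cboundedM (cbounded_cst _ _) (bp _).
apply: eq_bigr => c _; rewrite (bf_scale bfL); last exact: bp.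
by rewrite (divdiff_functional bfL rad0 far pole).
Qed.

End PathExpansion.

Lemma words_neq_nil r (s : seq 'I_r) W : s != [::] -> W \in words s -> W != [::].
Proof.
case: s => // j s _ /flattenP [_ /mapP [V _ ->]].
case: V => [|v V] /=; first by rewrite inE => /eqP ->.
by rewrite !inE => /or3P[/eqP ->|/eqP ->|/mapP[V' _ ->]].
Qed.

Section ContinuousDifferentiability.
Variable R : realType.

(** For [N > 1] the derivative is continuous because it is itself derivable. *)
Lemma times_cont_differentiable_C1 N (f : R[i]^o -> R[i]^o) Omega : (0 < N)%N ->
  times_cont_differentiable_on N f Omega ->
  (forall z, Omega z -> derivable f z 1) /\
  (forall z, Omega z -> {for z, continuous (derive1 f)}).
Proof.
move=> N0 [df cf]; split=> z Oz; first exact: (df 0%N).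
case: N N0 df cf => [//|[|N]] _ df cf; first exact: cf.
apply: differentiable_continuous; apply/derivable1_diffP.
exact: (df 1%N z).
Qed.

End ContinuousDifferentiability.

Theorem mainTheorem4 (R : realType) (r k n m : nat)
    (r_gt0 : (0 < r)%N) (k_gt0 : (0 < k)%N) (n_gt0 : (0 < n)%N)
    (m_gt0 : (0 < m)%N)
    (Omega : set R[i]^o) (Omega_open : open Omega)
    (A : 'rV[R]_r -> 'M[R[i]]_n) (x0 : 'rV[R]_r)
    (A_diff : times_differentiable k A x0)
    (A_class : \forall x \near x0, spectral_class Omega m (A x))
    (f : R[i]^o -> R[i]^o)
    (f_diff : times_cont_differentiable_on ((k.+1 * m).-1)%N f Omega)
    (A_herm : A x0 \is hermsymmx)
    (Q : 'M[R[i]]_n) (Q_unitary : Q \is unitarymx)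
    (lambda : 'rV[R[i]]_n)
    (A_diag : Q^t* *m A x0 *m Q = diag_mx lambda)
    (alpha : mindex r) (alpha_size : mi_size alpha = k) :
  let fA := fun x => matrix_fun f (A x) in
  let U := fun beta : mindex r => Q^t* *m mi_partial beta A x0 *m Q in
  has_mi_partial alpha fA x0 /\
  forall i j : 'I_n,
    (Q^t* *m mi_partial alpha fA x0 *m Q) i j =
    \sum_(1 <= l < (mi_size alpha).+1)
      \sum_(t <- mi_ordered_partitions alpha l)
        \sum_(c : l.-1.-tuple 'I_n)
          (* the path i, k_1, ..., k_(l-1), j *)
          let p := i :: rcons c j in
          (\prod_(a < l) U (tnth t a) (nth i p a) (nth i p a.+1)) *
          divdiff f [seq lambda 0 q | q <- p].
Proof.
move=> fA U.
have QQ := unitarymxP Q_unitary; have VQ := unitary_mulVmx Q_unitary.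
have N0 : (0 < (k.+1 * m).-1)%N.
  have : (k.+1 * 1 <= k.+1 * m)%N by rewrite leq_mul2l m_gt0 orbT.
  by move: k_gt0; lia.
have [df cf] := times_cont_differentiable_C1 N0 f_diff.
pose cs := [seq lambda 0 i | i <- enum 'I_n].
have lamcs i : lambda 0 i \in cs by apply: map_f; rewrite mem_enum.
have lam_eig i : eigenvalue (A x0) (lambda 0 i).
  have e : Q^t* *m A x0 = diag_mx lambda *m Q^t*.
    by rewrite -A_diag -!mulmxA QQ mulmx1.
  apply/eigenvalueP; exists (row i (Q^t*)).
    by rewrite -row_mul e mul_diag_mx; apply/rowP => j; rewrite !mxE.
  apply/negP => /eqP/(congr1 (mulmx^~ Q)); rewrite -row_mul VQ mul0mx.
  by move/rowP/(_ i)/eqP; rewrite !mxE eqxx oner_eq0.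
have csO c : c \in cs -> Omega c.
  move=> /mapP [i _ ->]; have [h _] := nbhs_singleton A_class.
  exact: h (lam_eig i).
have [G [L [rad [bfL rad0 far pole]]]] := exists_contour Omega_open df cf csO.
have far0 z c : G z -> c \in cs -> rad <= nc (z - c).
  by move=> Gz cc; apply: far Gz cc _; rewrite subrr nc0.
have pole0 c p : c \in cs ->
    L (fun z => (z - c)^-1 ^+ p.+1) = derive1n p f c / p`!%:R.
  by move=> cc; apply: pole cc _; rewrite subrr nc0.
(* Matrices within [e] of [A x0] have their eigenvalues within [rad] of those of [A x0], where [L]
   is exact on poles, and resolvents bounded by [C] on the contour. *)
have [e [C [e0 hres heig]]] := unitary_perturbation Q_unitary A_diag rad0.
have dA0 : mx_differentiable A x0.
  by have [] := times_differentiable_iter A_diff (s := [::]) k_gt0.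
have nA := mx_differentiable_near dA0 e0.
have A_res : \forall x \near x0, forall z, G z ->
    z%:M - A x \in unitmx /\ forall i j, nc (resolvent A x z i j) <= C.
  by apply: filterS nA => x hx z Gz; apply: (hres _ hx) => i; exact: far0.
have fA_eq : \forall x \near x0, fA x = mxfunctional L (resolvent A x).
  apply: filterS2 nA A_class => x hx [_ [J _]].
  apply: (matrix_fun_functional bfL J) => mu /(heig _ hx) [i hi]; split.
    by exists rad => // z Gz; apply: far Gz (lamcs i) hi.
  by move=> p; apply: pole (lamcs i) hi.
set s := mi_dirs alpha; have ssz : size s = k by rewrite size_mi_dirs.
have [[hs1 hs2] _] := iter_partial_functional bfL A_diff A_res fA_eq
  (eq_leq ssz) k_gt0.
split=> // i j; rewrite /mi_partial -/s hs2 mulmx_sumr mulmx_suml summxE.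
have s0 : s != [::] by rewrite -size_eq0 ssz -lt0n.
(* With [l] separate from [size V], the sum over words and the sum over ordered partitions share
   this summand. *)
pose term l (V : seq (mindex r)) : R[i] := \sum_(c : l.-1.-tuple 'I_n)
  (\prod_(a < l) U V`_a (nth i (i :: rcons c j) a) (nth i (i :: rcons c j) a.+1))
   * divdiff f [seq lambda 0 q | q <- i :: rcons c j].
transitivity (\sum_(W <- words s)
    (fun V => term (size V) V) (map (@word_sum r) W)).
  rewrite big_seq [RHS]big_seq; apply: eq_bigr => W Ws.
  have sub w : w \in W -> subseq w s by exact: mem_words_subseq.
  have W0 := words_neq_nil s0 Ws.
  have bW := word_resolvent_bounded W (nbhs_singleton A_res).
  case: W Ws W0 sub bW => // w W _ _ sub bW.
  rewrite (word_functional_path Q_unitary A_diag i j i bfL rad0 lamcs far0 pole0 bW).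
  rewrite /term size_map; apply: eq_bigr => c _; apply: (congr1 ( *%R^~ _)).
  (* Each letter is a subsequence of the sorted list [s], hence sorted, and so is recovered from its
     multi-index. *)
  apply: eq_bigr => a _; rewrite (nth_map [::]) // /U /mi_partial mi_dirs_word_sum //.
  apply: (subseq_sorted _ (sub _ (mem_nth _ (ltn_ord a)))); last exact: sorted_mi_dirs.
  by move=> x y z; exact: leq_trans.
rewrite (sum_words (fun V => term (size V) V) s0) size_mi_dirs; apply: eq_bigr => l _.
rewrite /mi_ordered_partitions big_allpairs_dep; apply: eq_bigr => u _.
rewrite big_enum /=; apply: eq_bigr => p _; rewrite size_perm_seq /term.
apply: eq_bigr => c _; apply: (congr1 ( *%R^~ _)); apply: eq_bigr => a _.
by rewrite nth_perm_seq tnth_mktuple.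
Qed.
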